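(* Let $\lambda,u,v,q,C_1,\dots,C_5$ be as in the context. There are constants $\alpha$ and $C_{10}$ (positive numbers depending only on $C_1,C_2,C_3,C_4,C_5,q,m,n$) such that $$\frac{\epsilon^\alpha}{C_{10}}\left[\frac1{u(Q)}\int_Q|g(z)|^q u(z)\,dz\right]\le\left[\left(\frac{s^2}{v(Q)}\int_{(1+\epsilon)Q}|\nabla_\lambda g(z)|^2v(z)\,dz\right)^{1/2}+\left(\frac1{u(Q)}\int_{(1+\epsilon)Q}g(z)^2u(z)\,dz\right)^{1/2}\right]^q$$ holds for every $Q=Q(z_0,s)$ with $z_0\in\mathbb{R}^N$ and $s>0$, every $0<\epsilon<1$, and every Lipschitz continuous function $g$, where $q>2$ is the exponent in the Sobolev-Poincaré inequality assumed in the context.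
   Context: Let $n,m\ge1$ be integers, $N=n+m$; write $z=(x,y)\in\mathbb{R}^n\times\mathbb{R}^m=\mathbb{R}^N$. For a ball $B$ in a metric space and $a>0$, $aB$ is the ball with the same center and $a$ times the radius. Assumptions on $\lambda:\mathbb{R}^n\to[0,\infty)$: it is continuous and vanishes possibly only on a set of isolated points; $\int_{2B_e}\lambda\,dx\le C_1\int_{B_e}\lambda\,dx$ for every Euclidean ball $B_e\subset\mathbb{R}^n$; $\sup_{B_e}\lambda\le C_2|B_e|^{-1}\int_{B_e}\lambda\,dx$ for every Euclidean ball $B_e\subset\mathbb{R}^n$ ($|\cdot|$ is Lebesgue measure). For $z_0=(x_0,y_0)\in\mathbb{R}^N$ and $r>0$: $\Lambda(z_0,r)=\sup_{|x-x_0|<r}\lambda(x)$ and $Q(z_0,r)=\{(x,y):|x-x_0|<r,\ |y-y_0|<r\Lambda(z_0,r)\}$. If $Q=Q(z_0,r)$ and $t>0$, then $tQ=Q(z_0,tr)$. An absolutely continuous curve $\gamma$ in $\mathbb{R}^N$ is subunit if for every $\zeta=(\xi,\eta)\in\mathbb{R}^n\times\mathbb{R}^m$ and almost every $t$ in its domain $\langle\gamma'(t),\zeta\rangle^2\le|\xi|^2+\lambda(\gamma(t))^2|\eta|^2$, where $\lambda(\gamma(t))$ means $\lambda$ evaluated at the $\mathbb{R}^n$-component of $\gamma(t)$. $\rho(z,w)$ is the infimum of all $T\ge0$ such that some subunit curve with domain $[0,T]$ joins $z$ and $w$. $\rho$ is a metric; $B(z_0,r)$ denotes its balls. There is a constant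 $b$, depending only on $n$ and $m$, with $Q(z_0,r/b)\subseteq B(z_0,r)\subseteq Q(z_0,br)$ for all $z_0\in\mathbb{R}^N$, $r>0$. $u,v$ are weights on $\mathbb{R}^N$ (non-negative, non-trivial, locally integrable functions) with $\int_{2B}u\le C_3\int_Bu$ and $\int_{2B}v\le C_4\int_Bv$ for all $\rho$-balls $B$. Write $u(E)=\int_Eu\,dz$, $v(E)=\int_Ev\,dz$ and $m_E(g)=u(E)^{-1}\int_Egu\,dz$. For Lipschitz $g$, $\nabla_\lambda g(z)=\big(\partial_{x_1}g,\dots,\partial_{x_n}g,\lambda(x)\partial_{y_1}g,\dots,\lambda(x)\partial_{y_m}g\big)(z)$. Sobolev-Poincaré inequality (assumed): there are $q>2$ and $C_5>0$, depending only on $u,v,\lambda,n,m$, such that for every Lipschitz continuous $g$ and every $\rho$-ball $B$ of radius $r$, $$\Big[\tfrac1{u(B)}\int_B|g-m_B(g)|^qu\,dz\Big]^{1/q}\le C_5\,r\Big[\tfrac1{v(B)}\int_B|\nabla_\lambda g|^2v\,dz\Big]^{1/2}.$$ *)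

(* Defs.v *)
(* R : realType is the field of real numbers and R^k is
   'rV[R]_k.  A point z = (x, y) of R^n x R^m is the row vector
   row_mx x y : 'rV[R]_(n + m), so x = lsubmx z and y = rsubmx z. *)
From HB Require Import structures.
From mathcomp Require Import all_boot all_order all_algebra.
From mathcomp Require Import all_classical all_reals all_analysis.

Set Implicit Arguments.
Unset Strict Implicit.
Unset Printing Implicit Defensive.
Import Order.TTheory GRing.Theory Num.Theory.
Import numFieldNormedType.Exports.

Local Open Scope classical_set_scope.
Local Open Scope ring_scope.

(* The library norm `|x| on 'rV[R]_k is the sup norm; it induces the same
   topology and the same Lipschitz functions as the Euclidean norm below. *)
Section euclidean.
Context {R : realType} {k : nat}.
Implicit Types u v : 'rV[R]_k.

Definition edot u v : R := \sum_(i < k) u 0 i * v 0 i.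

Definition enorm u : R := Num.sqrt (edot u u).

Definition eball u (r : R) : set 'rV[R]_k := [set v | enorm (v - u) < r].

End euclidean.

(* Lebesgue measure on R^k: Caratheodory's construction applied to the infimum
   of the total volumes of the countable covers by half-open boxes.  Measurable
   therefore means Lebesgue measurable, and the measure is complete. *)
Section lebesgue.
Context {R : realType} {k : nat}.

(* None stands for the empty set, which for k = 0 is not of the form ]a, b]. *)
Definition box (c : option ('rV[R]_k * 'rV[R]_k)) : set 'rV[R]_k :=
  if c is Some ab then [set x | forall i, ab.1 0 i < x 0 i <= ab.2 0 i]
  else set0.

Definition box_volume (c : option ('rV[R]_k * 'rV[R]_k)) : R :=
  if c is Some ab then \prod_(i < k) Num.max 0 (ab.2 0 i - ab.1 0 i) else 0.

Definition box_cover (A : set 'rV[R]_k) :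
    set (nat -> option ('rV[R]_k * 'rV[R]_k)) :=
  [set c | A `<=` \bigcup_j box (c j)].

Local Open Scope ereal_scope.

Definition lebesgue_outer (A : set 'rV[R]_k) : \bar R :=
  ereal_inf [set \sum_(j <oo) (box_volume (c j))%:E | c in box_cover A].

Lemma box_volume_ge0 c : (0 <= box_volume c)%R.
Proof.
by case: c => [ab|]//=; apply: prodr_ge0 => i _; rewrite le_max lexx.
Qed.

Lemma lebesgue_outer_ge0 A : 0 <= lebesgue_outer A.
Proof.
apply: le_ereal_inf_tmp => _ [c _ <-].
by apply: nneseries_ge0 => j _ _; rewrite lee_fin box_volume_ge0.
Qed.

Lemma lebesgue_outer0 : lebesgue_outer set0 = 0.
Proof.
apply/eqP; rewrite eq_le lebesgue_outer_ge0 andbT.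
apply: ereal_inf_lbound; exists (fun=> None); first by move=> x [].
by rewrite eseries0.
Qed.

Lemma le_lebesgue_outer : {homo lebesgue_outer : A B / A `<=` B >-> A <= B}.
Proof.
move=> A B AB; apply/ereal_inf_le_tmp => _ [c Bc <-].
by exists c => //; exact: subset_trans AB Bc.
Qed.

Lemma lebesgue_outer_sigma_subadditive : sigma_subadditive lebesgue_outer.
Proof.
move=> A; have [[i ioo]|] := pselect (exists i, lebesgue_outer (A i) = +oo).
  rewrite (eseries_pinfty _ _ ioo) ?leey// => n _.
  by rewrite -ltNye (lt_le_trans _ (lebesgue_outer_ge0 _)).
rewrite -forallNE => Aoo.
suff add2e (e : {posnum R}) : lebesgue_outer (\bigcup_n A n) <=
    \sum_(i <oo) lebesgue_outer (A i) + e%:num%:E.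
  by apply/lee_addgt0Pr => _/posnumP[].
rewrite (le_trans _ (epsilon_trick _ _ _))//; last first.
  by move=> n; exact: lebesgue_outer_ge0.
pose vol c := (box_volume c)%:E.
have vol0 c : 0 <= vol c by rewrite lee_fin box_volume_ge0.
pose P n B := box_cover (A n) B /\
  \sum_(j <oo) vol (B j) <= lebesgue_outer (A n) + (e%:num / (2 ^ n.+1)%:R)%:E.
have [G PG] : {G & forall n, P n (G n)}.
  apply: (@choice _ _ P) => n; rewrite /P /lebesgue_outer.
  set S := (X in ereal_inf X); move infS : (ereal_inf S) => iS.
  case: iS infS => [r Sr|Soo|Soo].
  - have en1 : (0 < e%:num / (2 ^ n.+1)%:R)%R by [].
    have /(lb_ereal_inf_adherent en1) : ereal_inf S \is a fin_num by rewrite Sr.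
    move=> [x [B AnB volBx] xS].
    by exists B; split => //; rewrite volBx -Sr; exact/ltW.
  - by case: (Aoo n).
  - have : lbound S 0; last by move/le_ereal_inf_tmp; rewrite Soo.
    by move=> _ [B AnB <-]; apply: nneseries_ge0 => j _ _; exact: vol0.
have volG_ge0 x : 0 <= (vol \o uncurry G) x by exact: vol0.
apply: (@le_trans _ _ (\esum_(i in setT) (vol \o uncurry G) i)).
  apply: ereal_inf_lbound => /=.
  have /card_esym/ppcard_eqP[f] := card_nat2.
  exists (uncurry G \o f).
    move=> t [i _ /((PG i).1) [j _ Gijt]].
    by exists (f^-1%FUN (i, j)) => //=; rewrite invK ?inE.
  rewrite -(esum_pred_image (vol \o uncurry G) _ xpredT) ?[fun=> _]set_true//.
  by rewrite image_eq.
rewrite (_ : esum _ _ = \sum_(i <oo) \sum_(j <oo ) vol (G i j)); last first.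
  pose J : nat -> set (nat * nat) := fun i => [set (i, j) | j in setT].
  rewrite (_ : setT = \bigcup_k J k); last first.
    by rewrite predeqE => -[a b]; split => // _; exists a => //; exists b.
  rewrite esum_bigcupT /=; last 2 first.
    - apply/trivIsetP => i j _ _ ij.
      rewrite predeqE => -[n m] /=; split => //= -[] [_] _ [<-{n} _].
      by move=> [m' _] [] /esym/eqP; rewrite (negbTE ij).
    - by move=> /= [n m]; exact: vol0.
  rewrite -(image_id [set: nat]) -fun_true esum_pred_image//; last first.
    by move=> n _; exact: esum_ge0.
  apply: eq_eseriesr => /= j _.
  rewrite -(esum_pred_image (vol \o uncurry G) (pair j) predT)//=; last first.
    by move=> ? ? _ _; exact: (@can_inj _ _ _ snd).
  by congr esum; rewrite predeqE => -[a b]; split; move=> [i _ <-]; exists i.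
apply: lee_lim.
- apply: is_cvg_nneseries => n *.
  by apply: nneseries_ge0 => m *; exact: (volG_ge0 (n, m)).
- by apply: is_cvg_nneseries => n *; apply: adde_ge0 => //;
    exact: lebesgue_outer_ge0.
- by near=> n; apply: lee_sum => i _; exact: (PG i).2.
Unshelve. all: by end_near. Qed.

HB.instance Definition _ := isOuterMeasure.Build R _ lebesgue_outer
  lebesgue_outer0 lebesgue_outer_ge0 le_lebesgue_outer
  lebesgue_outer_sigma_subadditive.

Definition rV_outer : {outer_measure set 'rV[R]_k -> \bar R} := lebesgue_outer.

Definition rV_lebesgue : {measure set (caratheodory_type rV_outer) -> \bar R} :=
  rV_outer : set (caratheodory_type rV_outer) -> \bar R.

End lebesgue.
Arguments rV_lebesgue {R} k.

(* All integrals below are Rintegral, i.e. real numbers: every integrand is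
   bounded, or a bounded function times a locally integrable one, on a bounded
   set, hence has a finite integral. *)
Section weights.
Context {R : realType} {k : nat}.
Implicit Types (w g : 'rV[R]_k -> R) (E : set 'rV[R]_k).

Definition vol E : R := fine (rV_lebesgue k E).

Definition rV_integral E g : R := \int[rV_lebesgue k]_(z in E) g z.

(* Non-trivial: not almost everywhere zero. *)
Definition weight w :=
  [/\ forall z, 0 <= w z,
      ~ {ae rV_lebesgue k, forall z, w z = 0},
      measurable_fun [set: caratheodory_type (@rV_outer R k)] w &
      forall K : set 'rV[R]_k, compact K ->
        (rV_lebesgue k).-integrable K (EFin \o w)].

Definition wmeas w E : R := rV_integral E w.

Definition wmean w E g : R := (wmeas w E)^-1 * rV_integral E (fun z => g z * w z).

End weights.

Section degenerate_geometry.
Context {R : realType} {n m : nat}.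
Implicit Types (lambda : 'rV[R]_n -> R) (z : 'rV[R]_(n + m)).

Definition admissible lambda (C1 C2 : R) :=
  [/\ forall x, 0 <= lambda x,
      continuous lambda,
      [set x | lambda x = 0] `<=` isolated [set x | lambda x = 0],
      (forall x r, 0 < r ->
        rV_integral (eball x (2 * r)) lambda <=
          C1 * rV_integral (eball x r) lambda) &
      (forall x r, 0 < r ->
        sup (lambda @` eball x r) <=
          C2 * ((vol (eball x r))^-1 * rV_integral (eball x r) lambda))].

Definition Lambda lambda z (r : R) : R := sup (lambda @` eball (lsubmx z) r).

Definition Qbox lambda z (r : R) : set 'rV[R]_(n + m) :=
  [set w | enorm (lsubmx w - lsubmx z) < r /\
           enorm (rsubmx w - rsubmx z) < r * Lambda lambda z r].

Definition abs_continuous (T : R) (gamma : R -> 'rV[R]_(n + m)) :=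
  forall e : R, 0 < e -> exists2 d : R, 0 < d &
    forall (p : nat) (s t : 'I_p -> R),
      (forall i, [/\ 0 <= s i, s i < t i & t i <= T]) ->
      trivIset setT (fun i => `]s i, t i[%classic) ->
      \sum_(i < p) (t i - s i) < d ->
      \sum_(i < p) enorm (gamma (t i) - gamma (s i)) < e.

(* A curve with domain [0, T] is a function on R of which only the values on
   [0, T] matter.  zeta = (xi, eta) = (lsubmx zeta, rsubmx zeta). *)
Definition subunit lambda (T : R) (gamma : R -> 'rV[R]_(n + m)) :=
  abs_continuous T gamma /\
  forall zeta : 'rV[R]_(n + m),
    {ae lebesgue_measure, forall t : R, t \in `[0, T] ->
      derivable gamma t 1 /\
      edot ('D_1 gamma t) zeta ^+ 2 <=
        enorm (lsubmx zeta) ^+ 2 +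
        lambda (lsubmx (gamma t)) ^+ 2 * enorm (rsubmx zeta) ^+ 2}.

Definition rho lambda z w : \bar R :=
  ereal_inf [set T%:E | T in
    [set T : R | 0 <= T /\
      exists gamma, [/\ subunit lambda T gamma, gamma 0 = z & gamma T = w]]].

Definition rho_ball lambda z (r : R) : set 'rV[R]_(n + m) :=
  [set w | (rho lambda z w < r%:E)%E].

Definition rho_doubling lambda (C : R) (w : 'rV[R]_(n + m) -> R) :=
  forall z r, 0 < r ->
    wmeas w (rho_ball lambda z (2 * r)) <= C * wmeas w (rho_ball lambda z r).

(* For Lipschitz g the partial derivatives exist almost everywhere; 'D_v g z is
   a default value at the other points. *)
Definition grad lambda (g : 'rV[R]_(n + m) -> R) z : 'rV[R]_(n + m) :=
  row_mx (\row_(i < n) 'D_(delta_mx 0 (lshift m i)) g z)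
         (\row_(j < m) (lambda (lsubmx z) * 'D_(delta_mx 0 (rshift n j)) g z)).

Definition sobolev_poincare lambda (u v : 'rV[R]_(n + m) -> R) (q C : R) :=
  forall (g : 'rV[R]_(n + m) -> R) z (r : R), lipschitz g -> 0 < r ->
    let B := rho_ball lambda z r in
    ((wmeas u B)^-1 *
       rV_integral B (fun w => `|g w - wmean u B g| `^ q * u w)) `^ q^-1 <=
    C * r *
    ((wmeas v B)^-1 *
       rV_integral B (fun w => enorm (grad lambda g w) ^+ 2 * v w)) `^ 2^-1.

End degenerate_geometry.

(* Main.v *)
(* Write Q(z, r) for the boxes and B(z, r) for the rho-balls.  A subunit curve
   of duration T moves x by at most T, and y by at most T times the supremum of
   lambda over the points that x visits; conversely a point of Q(z, r) is
   reached from z by moving in x to a near-maximum of lambda, then in y, then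
   in x.  Hence B(z, r) lies in Q(z, r), which lies in B(z, 8 r); the first
   inclusion needs Lambda > 0, that is, the isolation of the zeros of lambda.
   Let the boxes Q(z_i, epsilon s / 24), with centers z_i in Q = Q(z0, s), form
   a maximal disjoint family.  By doubling, their number and all the ratios of
   the u- and v-masses of (1 + epsilon) Q, Q and B(z_i, epsilon s) are at most a
   constant K of order epsilon^-a.  By maximality the balls B(z_i, epsilon s)
   cover Q, and they lie in (1 + epsilon) Q.  On each of them the
   Sobolev-Poincare inequality controls g minus its mean, and the
   Cauchy-Schwarz inequality controls the mean; sum over the balls. *)
Require Import Defs.
From mathcomp Require Import all_boot all_order all_algebra.
From mathcomp Require Import all_classical all_reals all_analysis.
From mathcomp Require Import measurable_realfun ring lra.
Import Order.TTheory GRing.Theory Num.Theory.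
Import numFieldNormedType.Exports.
Local Open Scope classical_set_scope.
Local Open Scope ring_scope.

Set Implicit Arguments.
Unset Strict Implicit.
Unset Printing Implicit Defensive.

(** * Lebesgue measurability *)

Section lebesgue_measurability.
Context {R : realType} {k : nat}.
Implicit Types (A X : set 'rV[R]_k) (c : R) (i : 'I_k).

(** The two pieces into which the hyperplane x_i = c cuts a box. If c lies outside the i-th side,
    one piece is inverted: it is empty, and the [max 0] in [box_volume] gives it volume 0. *)
Let below i c (ab : option ('rV[R]_k * 'rV[R]_k)) :=
  omap (fun ab : 'rV[R]_k * 'rV[R]_k => (ab.1,
    \row_j if j == i then Num.min (ab.2 0%R j) c
                                else ab.2 0%R j)%R) ab.
Let above i c (ab : option ('rV[R]_k * 'rV[R]_k)) :=
  omap (fun ab : 'rV[R]_k * 'rV[R]_k => (\row_j if j == i then Num.max (ab.1 0%R j) c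
                          else ab.1 0%R j, ab.2)%R) ab.

Let box_below i c ab :
  box ab `&` [set x : 'rV[R]_k | (x 0 i <= c)%R] `<=` box (below i c ab).
Proof.
case: ab => [[a b]|] x [] //= abx xc j; rewrite mxE.
have /andP[-> xb] := abx j; case: eqP => [ji|//]; subst j.
by rewrite /= le_min xb.
Qed.

Let box_above i c ab :
  box ab `&` ~` [set x : 'rV[R]_k | (x 0 i <= c)%R] `<=` box (above i c ab).
Proof.
case: ab => [[a b]|] x [] //= abx /negP; rewrite -ltNge => xc j; rewrite mxE.
have /andP[ax ->] := abx j; case: eqP => [ji|]; last by rewrite ax.
by subst j; rewrite /= gt_max ax xc.
Qed.

Let length_split (a b c : R) :
  (Num.max 0 (Num.min b c - a) + Num.max 0 (b - Num.max a c) =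
   Num.max 0 (b - a))%R.
Proof.
by rewrite !maxEle; case: (leP b c) => bc; case: (leP a c) => ac;
  repeat case: ifPn; lra.
Qed.

Let volume_split i c ab :
  (box_volume (below i c ab) + box_volume (above i c ab) = box_volume ab)%R.
Proof.
case: ab => [[a b]|] /=; last by rewrite addr0.
rewrite (bigD1 i) //= [X in (_ + X)%R](bigD1 i) //= [RHS](bigD1 i) //= !mxE eqxx.
under eq_bigr => j /negbTE ji do rewrite mxE ji.
under [X in (_ + _ * X)%R]eq_bigr => j /negbTE ji do rewrite mxE ji.
by rewrite -mulrDl length_split.
Qed.

(** Cutting every box of a cover of [X] along the hyperplane gives covers of the two parts of [X],
    and the volumes of the pieces add up exactly. *)
Lemma caratheodory_halfspace i c :
  (@rV_outer R k).-caratheodory [set x | (x 0 i <= c)%R].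
Proof.
apply: le_caratheodory_measurable => X.
apply: le_ereal_inf_tmp => _ [d Xd <-].
apply: (@le_trans _ _ (\sum_(j <oo) (box_volume (below i c (d j)))%:E +
   \sum_(j <oo) (box_volume (above i c (d j)))%:E)%E).
  apply: leeD; apply: ereal_inf_lbound => /=.
    exists (fun j => below i c (d j)) => // x [/Xd[j _ djx] xc].
    by exists j => //; apply: box_below.
  exists (fun j => above i c (d j)) => // x [/Xd[j _ djx] xc].
  by exists j => //; apply: box_above.
rewrite -nneseriesD; last 2 first.
- by move=> j _ _; rewrite lee_fin box_volume_ge0.
- by move=> j _ _; rewrite lee_fin box_volume_ge0.
by under eq_eseriesr do rewrite -EFinD volume_split.
Qed.

Lemma measurable_box ab :
  measurable (box ab : set (caratheodory_type (@rV_outer R k))).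
Proof.
case: ab => [[a b]|] //=.
rewrite [X in measurable X](_ : _ = \bigcap_i (
    [set x : 'rV[R]_k | (x 0 i <= b 0 i)%R]
    `\` [set x : 'rV[R]_k | (x 0 i <= a 0 i)%R])).
  apply: fin_bigcap_measurable => // i _.
  by apply: measurableD; exact: caratheodory_halfspace.
apply/seteqP; split=> x /=.
  by move=> abx i _; have /andP[ax xb] := abx i; split=> //=; rewrite leNgt ax.
move=> abx i; have [/= -> /negP] := abx i I.
by rewrite -ltNge => ->.
Qed.

(** An open set is the union of the boxes with rational corners that it contains, and these are
    countably many. *)
Lemma open_measurable_rV A : open A ->
  measurable (A : set (caratheodory_type (@rV_outer R k))).
Proof.
move=> oA.
pose C (p : 'rV[rat]_k * 'rV[rat]_k) : set 'rV[R]_k :=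
  let B := box (Some (map_mx ratr p.1, map_mx ratr p.2)) in
  if pselect (B `<=` A) then B else set0.
rewrite (_ : A = \bigcup_p C p); last first.
  apply/seteqP; split=> [x Ax|x [p _]]; last by rewrite /C; case: pselect => // BA /BA.
  have /nbhs_ballP[e /= e0 xeA] := oA _ Ax.
  have /choice[a Ha] (i : 'I_k) : exists q : rat, (x 0 i - e < ratr q < x 0 i)%R.
    have [|q] := @rat_in_itvoo R (x 0 i - e)%R (x 0 i); first
      by rewrite ltrBlDr ltrDl.
    by rewrite in_itv; exists q.
  have /choice[b Hb] (i : 'I_k) : exists q : rat, (x 0 i < ratr q < x 0 i + e)%R.
    have [|q] := @rat_in_itvoo R (x 0 i) (x 0 i + e)%R; first by rewrite ltrDl.
    by rewrite in_itv; exists q.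
  exists (\row_i a i, \row_i b i)%R => //; rewrite /C.
  case: pselect => [_ i|[]] /=.
    by rewrite !mxE; have /andP[_ ->] := Ha i; have /andP[/ltW-> _] := Hb i.
  move=> y /= aby; apply: xeA; split=> // i' i; rewrite (ord1 i') /ball /=.
    have := aby i; rewrite !mxE.
    have /andP[ai _] := Ha i; have /andP[_ bi] := Hb i.
    by move=> /andP[ya yb]; rewrite ltr_distlC (lt_trans ai ya) (le_lt_trans yb bi).
apply: countable_bigcupT_measurable => // p; rewrite /C; case: pselect => BA.
  exact: measurable_box.
exact: measurable0.
Qed.

Lemma continuous_measurable_rV (f : 'rV[R]_k -> R) : continuous f ->
  measurable_fun setT (f : caratheodory_type (@rV_outer R k) -> R).
Proof.
move=> /continuousP cf; apply: (measurability _ (RGenOpens.measurableE R)).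
move=> _ [_ [a [b ->] <-]]; rewrite setTI.
by apply: open_measurable_rV; exact/cf/interval_open.
Qed.

Lemma weight_integrable (w f : 'rV[R]_k -> R)
    (E : set (caratheodory_type (@rV_outer R k))) :
  weight w -> measurable E -> bounded_set (E : set 'rV[R]_k) ->
  measurable_fun setT (f : caratheodory_type (@rV_outer R k) -> R) ->
  [bounded f x | x in E] ->
  (rV_lebesgue k).-integrable E (EFin \o (fun z => f z * w z)).
Proof.
move=> [w0 _ mw iw] mE [M [_ EM]] mf bf.
(* Local integrability speaks of compact sets, so [E] is enclosed in a closed ball. The radius is
   [M + 1] because [bounded_set] gives the bounds strictly above [M]. *)
pose K := [set x : 'rV[R]_k | `|x| <= M + 1].
have cK : closed K.
  apply: (@preimage_closed _ _ (fun x : 'rV[R]_k => `|x|) [set y | y <= M + 1]).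
    by move=> x _; exact: norm_continuous.
  exact: closed_le.
have kK : compact K.
  apply: bounded_closed_compact => //; exists (M + 1); split; first exact: num_real.
  by move=> N MN x /= /le_trans; apply; exact: ltW.
have mK : measurable (K : set (caratheodory_type (@rV_outer R k))).
  by rewrite -[K]setCK; apply/measurableC/open_measurable_rV/closed_openC.
suff : (rV_lebesgue k).-integrable E ((EFin \o f) \* (EFin \o w))%E by [].
apply: integrableMr => //; first exact: measurable_funTS.
apply: (integrableS mK) => //; first by move=> x; apply: EM; rewrite ltrDl.
exact: iw.
Qed.

End lebesgue_measurability.

(* Monotonicity of the integral of non-negative functions holds without any
   measurability, because the integral is a supremum over simple functions. *)
Lemma le_integral_nonmeas d (T : measurableType d) (R : realType)
    (mu : {measure set T -> \bar R}) (A B : set T) (f g : T -> \bar R) :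
  A `<=` B -> (forall x, A x -> 0 <= f x)%E -> (forall x, B x -> 0 <= g x)%E ->
  (forall x, A x -> f x <= g x)%E ->
  (\int[mu]_(x in A) f x <= \int[mu]_(x in B) g x)%E.
Proof.
move=> AB f0 g0 fg; rewrite !ge0_integralE //.
apply: le_ereal_sup => _ [h /= hf <-]; exists h => //= x.
apply: (le_trans (hf x)); rewrite !patchE.
case: ifPn => [/set_mem Ax|_]; first by rewrite mem_set ?fg //; exact: AB.
by case: ifPn => // /set_mem; exact: g0.
Qed.

(** * Absolutely continuous functions *)

Section absolute_continuity.
Context {R : realType}.
Implicit Types (a b T L : R) (f : R -> R) (s : seq (R * R)).

(** Continuous induction: the local hypothesis at the supremum of the [t] with [P a t] extends [P a]
    to that point and beyond it, so the supremum must be [b]. *)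
Lemma full_cover_interval (P : R -> R -> Prop) a b : a <= b ->
  (forall x y z, x <= y -> y <= z -> P x y -> P y z -> P x z) ->
  (forall t, a <= t <= b -> exists2 d, 0 < d & forall x y,
     a <= x -> t - d < x -> x <= t -> t <= y -> y < t + d -> y <= b -> P x y) ->
  P a b.
Proof.
move=> ab Ptrans Ploc.
pose S := [set t | a <= t <= b /\ P a t].
have Sa : S a.
  have [|d d0 Pd] := Ploc a; first by rewrite lexx.
  by split; [rewrite lexx|apply: Pd => //; rewrite ?ltrDl // ltrBlDr ltrDl].
have supS : has_sup S by split; [exists a|exists b => t [/andP[]]].
have /andP[ac cb] : a <= sup S <= b.
  rewrite ub_le_sup //=; last by case: supS.
  by apply: ge_sup => [|t [/andP[]]]; first by exists a.
have [|d d0 Pd] := Ploc (sup S); first by rewrite ac.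
have [t [/andP[at_ tb] Pat] tc] := sup_adherent d0 supS.
have tS : t <= sup S by apply: ub_le_sup; [case: supS|split; rewrite ?at_].
pose y := Num.min b (sup S + d / 2).
have Say : S y.
  have cy : sup S <= y by rewrite le_min cb lerDl divr_ge0 // ltW.
  split; first by rewrite (le_trans ac cy) ge_min lexx.
  apply: (Ptrans _ t) => //; first exact: le_trans cy.
  apply: Pd => //; last by rewrite ge_min lexx.
  by rewrite gt_min; apply/orP; right; lra.
have : y <= sup S by apply: ub_le_sup => //; case: supS.
rewrite ge_min => /orP[bc|]; last by lra.
suff <- : y = b by case: Say.
by rewrite /y min_l //; lra.
Qed.

(** Families of intervals in [U] are kept as ordered lists, so that those of adjacent intervals can
    be concatenated. *)
Let chain (U : set R) x y s :=
  [/\ forall p, p \in s -> [/\ x <= p.1, p.1 < p.2, p.2 <= y &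
        `]p.1, p.2[%classic `<=` U] &
      pairwise (fun p q => p.2 <= q.1) s].

Let trivIset_chain U x y s : chain U x y s ->
  trivIset setT (fun i : 'I_(size s) =>
    `](nth (0, 0) s i).1, (nth (0, 0) s i).2[%classic).
Proof.
move=> [_ /(pairwiseP (0, 0)) sP]; apply/trivIsetP => i j _ _.
wlog ij : i j / (i < j)%N.
  move=> H ij; have [|/ltnW|/val_inj ijE] := ltngtP i j; first by move/H; apply.
    by rewrite leq_eqVlt => /predU1P[/val_inj ji|/H]; [rewrite ji eqxx in ij|
      rewrite setIC; apply; rewrite eq_sym].
  by rewrite ijE eqxx in ij.
move=> _; rewrite -subset0 => t /= []; rewrite !in_itv /= => /andP[_ ti] /andP[tj _].
have := sP i j (ltn_ord i) (ltn_ord j) ij.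
by move=> /(lt_le_trans ti) /lt_trans /(_ tj); rewrite ltxx.
Qed.

Let chain_length (U : set R) x y s : open U -> chain U x y s ->
  ((\sum_(i < size s) ((nth (0, 0) s i).2 - (nth (0, 0) s i).1))%:E <=
   lebesgue_measure U)%E.
Proof.
move=> oU sU; pose I (i : 'I_(size s)) :=
  `](nth (0, 0) s i).1, (nth (0, 0) s i).2[%classic : set R.
have sI (i : 'I_(size s)) := sU.1 _ (mem_nth (0, 0) (ltn_ord i)).
rewrite -sumEFin (eq_bigr (fun i => lebesgue_measure (I i))); last first.
  move=> i _; have [_ + _ _] := sI i.
  by rewrite lebesgue_measure_itv /= lte_fin => ->; rewrite EFinB.
rewrite -(measure_bigsetU_ord lebesgue_measure xpredT (F := I)) //; last first.
  exact: trivIset_chain sU.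
  by move=> i; exact: measurable_itv.
apply: le_measure; rewrite ?inE.
- by apply: bigsetU_measurable => i _; exact: measurable_itv.
- exact: open_measurable.
- apply: (@big_ind _ (fun A => A `<=` U)) => [t []||i _] //.
    by move=> A B AU BU t [/AU|/BU].
  by have [] := sI i.
Qed.

Definition abs_continuous_real T f :=
  forall e : R, 0 < e -> exists2 d : R, 0 < d &
    forall (p : nat) (s t : 'I_p -> R),
      (forall i, [/\ 0 <= s i, s i < t i & t i <= T]) ->
      trivIset setT (fun i => `]s i, t i[%classic) ->
      \sum_(i < p) (t i - s i) < d ->
      \sum_(i < p) `|f (t i) - f (s i)| < e.

(* Away from a null set [E] the increments of [f] are at most [(L + e) * h];
   [E] is covered by an open set [U] so small that, by absolute continuity, the
   total increment of [f] over disjoint intervals of [U] is at most [e]. *)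
Lemma abs_continuous_lipschitz T L f : 0 <= L -> abs_continuous_real T f ->
  {ae lebesgue_measure, forall t : R, t \in `[0, T] ->
    forall e, 0 < e -> \forall y \near t, `|f y - f t| <= (L + e) * `|y - t|} ->
  forall a b, 0 <= a -> a <= b -> b <= T -> `|f b - f a| <= L * (b - a).
Proof.
move=> L0 ACf [E [mE E0 fE]] a b a0 ab bT.
suff H e : 0 < e -> `|f b - f a| <= (L + e) * (b - a) + e.
  apply/ler_addgt0Pr => e e0.
  have ba : 0 < b - a + 1 by lra.
  (* With e' = e / (b - a + 1) the two errors e' (b - a) and e' add up to [e]. *)
  have e'0 : 0 < e / (b - a + 1) by rewrite divr_gt0.
  apply: (le_trans (H _ e'0)); rewrite le_eqVlt; apply/orP; left; apply/eqP.
  rewrite mulrDl -addrA; congr (_ + _).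
  by rewrite -[X in _ + X]mulr1 -mulrDr divfK // gt_eqF.
move=> e0; have [d d0 fd] := ACf e e0.
have [U [oU EU Ud]] : exists U : set R,
    [/\ open U, E `<=` U & (lebesgue_measure U < d%:E)%E].
  have Ey : (lebesgue_measure E < +oo)%E by rewrite E0.
  have [U [oU EU Ud]] := lebesgue_regularity_outer mE Ey d0.
  exists U; split => //; rewrite -(setDUK EU) setUC.
  apply: le_lt_trans Ud; rewrite -[leRHS]adde0 -E0.
  apply: measureU2 => //; apply: measurableD => //; exact: open_measurable.
pose inc s := \sum_(p <- s) `|f p.2 - f p.1|.
(* The chain absorbs the stretches without a slope bound. Concatenation gives transitivity; near a
   point of [U] the chain is one interval, and near a point outside [U], hence outside [E], the
   empty chain suffices. *)
pose P x y := exists s, chain U x y s /\ `|f y - f x| <= (L + e) * (y - x) + inc s.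
have [s [sU fs]] : P a b.
  apply: full_cover_interval => //.
    move=> x y z xy yz [s [[sU ss] fs]] [t [[tU ts] ft]]; exists (s ++ t); split.
      split=> [p|].
        rewrite mem_cat => /orP[/sU[? ? py ?]|/tU[yp ? ? ?]]; split => //.
          exact: le_trans py yz.
        exact: le_trans xy yp.
      rewrite pairwise_cat ss ts !andbT; apply/allrelP => p q /sU[_ _ py _].
      by move=> /tU[yq _ _ _]; exact: le_trans py yq.
    rewrite /inc big_cat /=.
    have := ler_normD (f z - f y) (f y - f x).
    rewrite addrA subrK -/(inc s) -/(inc t); lra.
  move=> t /andP[at_ tb].
  have t0T : t \in `[0, T].
    by rewrite in_itv /= (le_trans a0 at_) (le_trans tb bT).
  have [Ut|nUt] := pselect (U t).
    have /nbhs_ballP[r /= r0 rU] := oU _ Ut.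
    exists r => // x y ax tx xt ty yt yb.
    have [xy|yx] := ltP x y; last first.
      have -> : y = x by apply/eqP; rewrite eq_le yx (le_trans xt ty).
      exists [::]; split; first by split.
      by rewrite /inc big_nil !subrr normr0 mulr0 addr0.
    exists [:: (x, y)]; split.
      split=> // p; rewrite inE => /eqP-> /=; split => // z /=.
      rewrite in_itv /= => /andP[xz zy]; apply: rU; rewrite /ball /=.
      by rewrite ltr_distlC; apply/andP; split; lra.
    rewrite /inc big_seq1 /= lerDr mulr_ge0 //; lra.
  have /(_ t0T e e0)/nbhs_ballP[r /= r0 fr] : t \in `[0, T] ->
      forall e, 0 < e -> \forall y \near t, `|f y - f t| <= (L + e) * `|y - t|.
    by apply: contra_notP nUt => nft; apply/EU/fE => /nft.
  exists r => // x y ax tx xt ty yt yb; exists [::]; split; first by split.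
  rewrite /inc big_nil addr0.
  have /fr fx : ball t r x by rewrite /ball /= ltr_distlC; apply/andP; split; lra.
  have /fr fy : ball t r y by rewrite /ball /= ltr_distlC; apply/andP; split; lra.
  have := ler_normD (f y - f t) (f t - f x); rewrite addrA subrK => /le_trans; apply.
  rewrite [`|f t - _|]distrC (le_trans (lerD fy fx)) //.
  rewrite ger0_norm ?subr_ge0 // ler0_norm ?subr_le0 // -mulrDr.
  by rewrite le_eqVlt; apply/orP; left; apply/eqP; congr (_ * _); lra.
rewrite (le_trans fs) // lerD2l ltW // /inc (big_nth (0, 0)) big_mkord.
apply: fd => //.
- move=> i; have [ai ? ib _] := sU.1 _ (mem_nth (0, 0) (ltn_ord i)).
  by split => //; [exact: le_trans ai|exact: le_trans bT].
- exact: trivIset_chain sU.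
- by rewrite -lte_fin; apply: le_lt_trans Ud; exact: chain_length sU.
Qed.
End absolute_continuity.

(** * Euclidean norm *)

Section euclidean_norm.
Context {R : realType} {k : nat}.
Implicit Types u v w : 'rV[R]_k.

Lemma edotC u v : edot u v = edot v u.
Proof. by apply: eq_bigr => i _; rewrite mulrC. Qed.

Lemma edotDl u v w : edot (u + v) w = edot u w + edot v w.
Proof. by rewrite -big_split; apply: eq_bigr => i _; rewrite mxE mulrDl. Qed.

Lemma edotZl c u w : edot (c *: u) w = c * edot u w.
Proof. by rewrite mulr_sumr; apply: eq_bigr => i _; rewrite mxE mulrA. Qed.

Lemma edotNl u w : edot (- u) w = - edot u w.
Proof. by rewrite -scaleN1r edotZl mulN1r. Qed.

Lemma edotBl u v w : edot (u - v) w = edot u w - edot v w.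
Proof. by rewrite edotDl edotNl. Qed.

Lemma edot0l w : edot 0 w = 0.
Proof. by rewrite -(scale0r 0) edotZl mul0r. Qed.

Lemma edot0r w : edot w 0 = 0.
Proof. by rewrite edotC edot0l. Qed.

Lemma edot_ge0 u : 0 <= edot u u.
Proof. by apply: sumr_ge0 => i _; rewrite -expr2 sqr_ge0. Qed.

Lemma enorm_ge0 u : 0 <= enorm u.
Proof. exact: sqrtr_ge0. Qed.

Lemma sqr_enorm u : enorm u ^+ 2 = edot u u.
Proof. by rewrite sqr_sqrtr // edot_ge0. Qed.

Lemma enormN u : enorm (- u) = enorm u.
Proof. by rewrite /enorm edotNl edotC edotNl opprK. Qed.

Lemma enormB u v : enorm (u - v) = enorm (v - u).
Proof. by rewrite -enormN opprB. Qed.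

Lemma enorm0 : enorm (0 : 'rV[R]_k) = 0.
Proof. by rewrite /enorm edot0l sqrtr0. Qed.

Lemma enormZ c u : enorm (c *: u) = `|c| * enorm u.
Proof.
by rewrite /enorm edotZl edotC edotZl mulrA -expr2 sqrtrM ?sqr_ge0 // sqrtr_sqr.
Qed.

(** Cauchy-Schwarz, by expanding the square of [edot v v *: u - edot u v *: v]. *)
Lemma edot_le_enorm u v : `|edot u v| <= enorm u * enorm v.
Proof.
have [v0|v0] := eqVneq (edot v v) 0.
  have vE i : v 0 i = 0.
    apply/eqP; rewrite -sqrf_eq0 expr2; apply/eqP.
    by apply: (psumr_eq0P _ v0) => // j _; rewrite -expr2 sqr_ge0.
  rewrite /edot big1 ?normr0 ?mulr_ge0 ?enorm_ge0 // => i _.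
  by rewrite vE mulr0.
have {}v0 : 0 < edot v v by rewrite lt_def v0 edot_ge0.
rewrite -(@ler_pXn2r _ 2) ?nnegrE ?mulr_ge0 ?enorm_ge0 //.
rewrite exprMn !sqr_enorm real_normK ?num_real //.
have := edot_ge0 (edot v v *: u - edot u v *: v).
rewrite edotBl !edotZl ![edot _ (_ - _)]edotC !edotBl !edotZl (edotC v u) => H.
rewrite -(ler_pM2l v0); move: H; nra.
Qed.

Lemma ler_enormD u v : enorm (u + v) <= enorm u + enorm v.
Proof.
rewrite -(@ler_pXn2r _ 2) ?nnegrE ?addr_ge0 ?enorm_ge0 //.
rewrite sqrrD !sqr_enorm edotDl ![edot _ (_ + _)]edotC !edotDl (edotC v u).
have := edot_le_enorm u v; have := ler_norm (edot u v); lra.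
Qed.

Lemma ler_enormB u v w : enorm (u - w) <= enorm (u - v) + enorm (v - w).
Proof. by rewrite -[u - w](subrKA v) ler_enormD. Qed.

Lemma coord_le_enorm u i : `|u 0 i| <= enorm u.
Proof.
rewrite -sqrtr_sqr ler_wsqrtr // /edot (bigD1 i) //= -expr2 lerDl.
by apply: sumr_ge0 => j _; rewrite -expr2 sqr_ge0.
Qed.

Lemma norm_le_enorm u : `|u| <= enorm u.
Proof.
rewrite [leLHS]/Num.Def.normr /= mx_normrE; apply: bigmax_le; first exact: enorm_ge0.
by move=> [i j] _ /=; rewrite (ord1 i) coord_le_enorm.
Qed.

Lemma continuous_enorm : continuous (@enorm R k).
Proof.
move=> u; apply: (@continuous_comp _ _ _ (fun u => edot u u) Num.sqrt).
  apply: continuous_big => //=; first exact: add_continuous.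
  by move=> i _ {}u; apply: continuousM; exact: coord_continuous.
exact: sqrt_continuous.
Qed.

Lemma continuous_edotl w : continuous (fun u : 'rV[R]_k => edot u w).
Proof.
apply: continuous_big => //=; first exact: add_continuous.
by move=> i _ u; apply: continuousM; [exact: coord_continuous|exact: cst_continuous].
Qed.

End euclidean_norm.

(** * Points split into their x- and y-blocks *)

Section row_blocks.
Context {R : realType} {n m : nat}.
Implicit Types z w : 'rV[R]_(n + m).

Lemma edot_blocks z w :
  edot z w = edot (lsubmx z) (lsubmx w) + edot (rsubmx z) (rsubmx w).
Proof.
by rewrite /edot big_split_ord; congr (_ + _); apply: eq_bigr => i _;
  rewrite !mxE.
Qed.

Lemma enorm_blocks z : enorm z <= enorm (lsubmx z) + enorm (rsubmx z).
Proof.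
rewrite -(@ler_pXn2r _ 2) ?nnegrE ?addr_ge0 ?enorm_ge0 //.
rewrite sqrrD !sqr_enorm edot_blocks.
by rewrite addrAC lerDl mulrn_wge0 // mulr_ge0 // enorm_ge0.
Qed.

Lemma continuous_rsubmx :
  continuous (rsubmx : 'rV[R]_(n + m) -> 'rV[R]_m).
Proof.
move=> u A /nbhs_ballP[e /= e0 eA].
apply/nbhs_ballP; exists e => //= v [_ uv]; apply: eA; split => // i j.
by rewrite !mxE; exact: uv.
Qed.

End row_blocks.

(** * Boxes *)

Section degenerate_boxes.
Context {R : realType} {n m : nat}.
Variable lambda : 'rV[R]_n -> R.
Hypothesis lambda_ge0 : forall x, 0 <= lambda x.
Hypothesis lambda_cont : continuous lambda.
Implicit Types z w p : 'rV[R]_(n + m).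

(** [sup] has its usual properties for nonempty sets that are bounded above; the bound comes from
    the compactness of the closed ball. *)
Lemma has_sup_eball x r : 0 < r -> has_sup (lambda @` eball x r).
Proof.
move=> r0; split.
  by exists (lambda x), x => //; rewrite /eball /= subrr enorm0.
pose K := [set y : 'rV[R]_n | enorm (y - x) <= r].
have cK : compact K.
  apply: bounded_closed_compact.
    exists (r + `|x|); split; first exact: num_real.
    move=> M rM y /= Ky; apply: le_trans (ltW rM).
    rewrite -[y](subrK x) (le_trans (ler_normD _ _)) // lerD2r.
    exact: le_trans (norm_le_enorm _) Ky.
  apply: (@preimage_closed _ _ (fun y : 'rV[R]_n => enorm (y - x)) [set t : R | t <= r]).
    move=> y _; apply: continuous_comp; last exact: continuous_enorm.
    by apply: continuousB => //; exact: cst_continuous.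
  exact: closed_le.
have : compact (lambda @` K).
  by apply: continuous_compact => //; exact: continuous_subspaceT.
move=> /compact_bounded[M [_ MK]]; exists (M + 1) => _ [y ry <-].
rewrite (le_trans (ler_norm _)) // MK ?ltrDl //.
by exists y => //; exact: ltW.
Qed.

Lemma le_Lambda z r x : enorm (x - lsubmx z) < r -> lambda x <= Lambda lambda z r.
Proof.
move=> xr; apply: ub_le_sup; last by exists x.
by case: (@has_sup_eball (lsubmx z) r) => //; exact: le_lt_trans (enorm_ge0 _) xr.
Qed.

Lemma Lambda_subset z w r r' : 0 < r ->
  eball (lsubmx z) r `<=` eball (lsubmx w) r' ->
  Lambda lambda z r <= Lambda lambda w r'.
Proof.
move=> r0 sub; apply: ge_sup; first by case: (has_sup_eball (lsubmx z) r0).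
by move=> _ [x /sub zx <-]; exact: le_Lambda.
Qed.

(** If the center is a zero of [lambda], it is an isolated one, and for n > 0 the ball contains
    other points close to it, where [lambda] is positive. *)
Lemma Lambda_gt0 z r : (0 < n)%N ->
  [set x | lambda x = 0] `<=` isolated [set x | lambda x = 0] ->
  0 < r -> 0 < Lambda lambda z r.
Proof.
move=> n0 iso r0; set x0 := lsubmx z.
have [x0E|x0N] := eqVneq (lambda x0) 0; last first.
  apply: (@lt_le_trans _ _ (lambda x0)); first by rewrite lt_def x0N lambda_ge0.
  by apply: le_Lambda; rewrite subrr enorm0.
have [_ [V /nbhs_ballP[e /= e0 eV] VE]] := iso _ x0E.
pose i : 'I_n := Ordinal n0; pose d := Num.min e r / 2.
have d0 : 0 < d by rewrite divr_gt0 // lt_min e0.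
have dE : enorm (d *: delta_mx 0 i : 'rV[R]_n) = d.
  rewrite enormZ gtr0_norm // /enorm /edot (bigD1 i) //= big1 => [|j /negbTE ji].
    by rewrite mxE !eqxx mulr1 addr0 sqrtr1 mulr1.
  by rewrite mxE ji andbF mulr0.
pose x1 := x0 + d *: delta_mx 0 i.
have x1x0 : x1 - x0 = d *: delta_mx 0 i by rewrite /x1 addrC addKr.
have ed : d < e by rewrite /d ltr_pdivrMr // gt_min ltr_pMr // ltr1n.
have rd : d < r.
  by rewrite /d ltr_pdivrMr // gt_min; apply/orP; right; rewrite ltr_pMr // ltr1n.
apply: (@lt_le_trans _ _ (lambda x1)); last by apply: le_Lambda; rewrite x1x0 dE.
rewrite lt_def lambda_ge0 andbT; apply/eqP => x1E.
have : [set x0] x1.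
  rewrite -VE; split => //; apply: eV.
  by rewrite -ball_normE /= distrC x1x0 (le_lt_trans (norm_le_enorm _)) // dE.
by move=> /= x1x0'; move: dE; rewrite -x1x0 x1x0' subrr enorm0 => /eqP; rewrite lt_eqF.
Qed.

(** The Euclidean ball of radius [r] about the x-part of [z0] lies in that of radius [2 * r] about
    the x-part of [z], so [Lambda] does not decrease. *)
Lemma Qbox_sub2 z0 z w r : 0 < r ->
  Qbox lambda z0 r z -> Qbox lambda z0 r w -> Qbox lambda z (2 * r) w.
Proof.
move=> r0 [zx zy] [wx wy].
have L : Lambda lambda z0 r <= Lambda lambda z (2 * r).
  apply: Lambda_subset => // x /= xr; rewrite /eball /=.
  have := ler_enormB x (lsubmx z0) (lsubmx z).
  by rewrite (enormB (lsubmx z0)); move: xr; rewrite /eball /=; lra.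
split.
  have := ler_enormB (lsubmx w) (lsubmx z0) (lsubmx z).
  by rewrite (enormB (lsubmx z0)); lra.
have := ler_enormB (rsubmx w) (rsubmx z0) (rsubmx z); rewrite (enormB (rsubmx z0)).
by nra.
Qed.

(** The factor is 3, not 2, because the y-size of the second box depends on [lambda] over the ball
    of radius [r] about the x-part of [w], whose distance from the x-part of [z] may be close to
    [2 * r]. *)
Lemma Qbox_meet z w r : 0 < r ->
  Qbox lambda z r `&` Qbox lambda w r !=set0 -> Qbox lambda z (3 * r) w.
Proof.
move=> r0 [v [[zx zy] [wx wy]]].
have wz : enorm (lsubmx w - lsubmx z) < 2 * r.
  have := ler_enormB (lsubmx w) (lsubmx v) (lsubmx z).
  by rewrite (enormB (lsubmx w) (lsubmx v)); lra.
split; first by lra.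
have Lz : Lambda lambda z r <= Lambda lambda z (3 * r).
  by apply: Lambda_subset => // x; rewrite /eball /=; lra.
have Lw : Lambda lambda w r <= Lambda lambda z (3 * r).
  apply: Lambda_subset => // x; rewrite /eball /= => xr.
  by have := ler_enormB x (lsubmx w) (lsubmx z); lra.
have L0 : 0 <= Lambda lambda z (3 * r).
  apply: le_trans (lambda_ge0 (lsubmx z)) _; apply: le_Lambda.
  by rewrite subrr enorm0; lra.
have := ler_enormB (rsubmx w) (rsubmx v) (rsubmx z).
rewrite (enormB (rsubmx w) (rsubmx v)).
by nra.
Qed.

(** Both y-sizes are governed by values of [lambda] below [Lambda lambda z0 (r + d)], so the y-radii
    add up like the x-radii. This puts small boxes centered in Q inside (1 + epsilon) Q. *)
Lemma Qbox_sub z0 z r d : 0 < r -> 0 < d ->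
  Qbox lambda z0 r z -> Qbox lambda z d `<=` Qbox lambda z0 (r + d).
Proof.
move=> r0 d0 [zx zy] w [wx wy].
have L : Lambda lambda z0 r <= Lambda lambda z0 (r + d).
  by apply: Lambda_subset => // x; rewrite /eball /=; lra.
have L' : Lambda lambda z d <= Lambda lambda z0 (r + d).
  apply: Lambda_subset => // x; rewrite /eball /= => xr.
  by have := ler_enormB x (lsubmx z) (lsubmx z0); lra.
split.
  by have := ler_enormB (lsubmx w) (lsubmx z) (lsubmx z0); lra.
have := ler_enormB (rsubmx w) (rsubmx z) (rsubmx z0).
by nra.
Qed.

Lemma Qbox_center z r : 0 < r -> 0 < Lambda lambda z r -> Qbox lambda z r z.
Proof. by move=> r0 L0; split; rewrite subrr enorm0 // mulr_gt0. Qed.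

Lemma Qbox_subset z r r' : 0 < r -> r <= r' ->
  Qbox lambda z r `<=` Qbox lambda z r'.
Proof.
move=> r0 rr' w [wx wy]; split; first exact: lt_le_trans wx rr'.
apply: (lt_le_trans wy); apply: ler_pM => //; first exact: ltW.
  apply: le_trans (lambda_ge0 (lsubmx z)) _; apply: le_Lambda.
  by rewrite subrr enorm0.
by apply: Lambda_subset => // x; rewrite /eball /=; lra.
Qed.

Lemma open_Qbox z r : open (Qbox lambda z r).
Proof.
rewrite (_ : Qbox _ _ _ = [set w | enorm (lsubmx w - lsubmx z) < r] `&`
  [set w | enorm (rsubmx w - rsubmx z) < r * Lambda lambda z r]); last first.
  by apply/seteqP; split=> w.
apply: openI.
  apply: (@open_comp _ _ (fun w => enorm (lsubmx w - lsubmx z)) [set t : R | t < r]).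
    move=> w _; apply: continuous_comp; last exact: continuous_enorm.
    apply: continuousB; first exact: continuous_lsubmx.
    exact: cst_continuous.
  exact: open_lt.
apply: (@open_comp _ _ (fun w => enorm (rsubmx w - rsubmx z))
  [set t : R | t < r * Lambda lambda z r]).
  move=> w _; apply: continuous_comp; last exact: continuous_enorm.
  apply: continuousB; first exact: continuous_rsubmx.
  exact: cst_continuous.
exact: open_lt.
Qed.

Lemma bounded_Qbox z r : bounded_set (Qbox lambda z r).
Proof.
exists (r + r * Lambda lambda z r + `|z|); split; first exact: num_real.
move=> M rM w /= [wx wy]; apply: le_trans (ltW rM).
rewrite -[w](subrK z) (le_trans (ler_normD _ _)) // lerD2r.
apply: (le_trans (norm_le_enorm _)); apply: (le_trans (enorm_blocks _)).
by rewrite !linearB lerD // ltW.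
Qed.

End degenerate_boxes.

(** * Subunit curves *)

Section subunit_curves.
Context {R : realType} {n m : nat}.
Variable lambda : 'rV[R]_n -> R.
Hypothesis lambda_ge0 : forall x, 0 <= lambda x.
Hypothesis lambda_cont : continuous lambda.
Implicit Types (z w p zeta : 'rV[R]_(n + m)) (gamma : R -> 'rV[R]_(n + m)).

(** The difference quotients in direction [zeta] tend to a number of modulus at most [L]; this
    yields the pointwise hypothesis of [abs_continuous_lipschitz]. *)
Lemma near_edot_derive gamma (t : R) zeta (L : R) : derivable gamma t 1 ->
  `|edot ('D_1 gamma t) zeta| <= L -> forall e : R, 0 < e ->
  \forall y \near t, `|edot (gamma y) zeta - edot (gamma t) zeta| <=
    (L + e) * `|y - t|.
Proof.
move=> dg gL e e0.
have : edot (h^-1 *: (gamma (h *: 1 + t) - gamma t)) zeta @[h --> 0^'] -->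
    edot ('D_1 gamma t) zeta.
  exact: (cvg_comp _ _ dg (@continuous_edotl _ _ zeta ('D_1 gamma t))).
move=> /cvgrPdist_lt /(_ e e0); rewrite near_withinE => /nbhs_ballP[d /= d0 dP].
apply/nbhs_ballP; exists d => // y; rewrite -ball_normE /= => ty.
have [->|yt] := eqVneq y t; first by rewrite !subrr normr0 mulr0.
have h0 : y - t != 0 by rewrite subr_eq0.
have := dP (y - t); rewrite -ball_normE /= sub0r normrN => /(_ _ h0).
move/(_ (eq_ind_r (fun x => x < d) ty (distrC y t))).
rewrite edotZl edotBl /GRing.scale /= mulr1 subrK => H.
suff : `|(edot (gamma y) zeta - edot (gamma t) zeta) / (y - t)| <= L + e.
  by rewrite normf_div ler_pdivrMr ?normr_gt0.
rewrite mulrC in H.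
have := ler_normB (edot ('D_1 gamma t) zeta)
  (edot ('D_1 gamma t) zeta - (edot (gamma y) zeta - edot (gamma t) zeta) / (y - t)).
by rewrite opprB addrC subrK; lra.
Qed.

Lemma abs_continuous_edot T gamma zeta : abs_continuous T gamma ->
  abs_continuous_real T (fun t => edot (gamma t) zeta).
Proof.
move=> ACg e e0; have c0 : 0 < enorm zeta + 1 by have := enorm_ge0 zeta; lra.
have [|d d0 dP] := ACg (e / (enorm zeta + 1)); first by rewrite divr_gt0.
exists d => // k s t st tI std; have := dP k s t st tI std.
rewrite ltr_pdivlMr // => /(le_lt_trans _); apply.
rewrite mulr_suml; apply: ler_sum => i _; rewrite -edotBl.
apply: (le_trans (edot_le_enorm _ _)); rewrite ler_wpM2l ?enorm_ge0 //; lra.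
Qed.

(** The subunit condition bounds the derivative of [edot (gamma t) zeta] almost everywhere by [L],
    and absolute continuity integrates this. The direction is fixed, since the exceptional null set
    may depend on it. *)
Lemma subunit_edot_le T gamma zeta L : subunit lambda T gamma -> 0 <= L ->
  (forall t, t \in `[0, T] -> enorm (lsubmx zeta) ^+ 2 +
     lambda (lsubmx (gamma t)) ^+ 2 * enorm (rsubmx zeta) ^+ 2 <= L ^+ 2) ->
  forall a b, 0 <= a -> a <= b -> b <= T ->
  `|edot (gamma b - gamma a) zeta| <= L * (b - a).
Proof.
move=> [ACg sg] L0 gL a b a0 ab bT; rewrite edotBl.
apply: (@abs_continuous_lipschitz _ T L (fun t => edot (gamma t) zeta)) => //.
  exact: abs_continuous_edot.
have := sg zeta.
apply: (@filterS _ _ (ae_filter_ringOfSetsType lebesgue_measure)) => t gt tT.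
have [dg gz] := gt tT.
apply: near_edot_derive => //.
rewrite -(@ler_pXn2r _ 2) ?nnegrE // real_normK ?num_real //.
exact: le_trans gz (gL t tT).
Qed.

Let lrow0 (x : 'rV[R]_n) :
  (lsubmx (row_mx x (0 : 'rV[R]_m)) = x) * (rsubmx (row_mx x (0 : 'rV[R]_m)) = 0).
Proof. by rewrite row_mxKl row_mxKr. Qed.

Let rrow0 (y : 'rV[R]_m) :
  (lsubmx (row_mx (0 : 'rV[R]_n) y) = 0) * (rsubmx (row_mx (0 : 'rV[R]_n) y) = y).
Proof. by rewrite row_mxKl row_mxKr. Qed.

Let self_le (k : nat) (u : 'rV[R]_k) c : 0 <= c ->
  edot u u <= enorm u * c -> enorm u <= c.
Proof.
move=> c0; rewrite -sqr_enorm expr2 => H.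
have [u0|u0] := eqVneq (enorm u) 0; first by rewrite u0.
by rewrite -(ler_pM2l (_ : 0 < enorm u)) // lt_def u0 enorm_ge0.
Qed.

(** The curve is tested against its own x-increment, extended by 0 in y, for which the term with
    [lambda] vanishes. *)
Lemma subunit_lsubmx T gamma : subunit lambda T gamma ->
  forall a b, 0 <= a -> a <= b -> b <= T ->
  enorm (lsubmx (gamma b) - lsubmx (gamma a)) <= b - a.
Proof.
move=> sg a b a0 ab bT; rewrite -linearB /=.
apply: self_le; first by rewrite subr_ge0.
have := @subunit_edot_le T gamma (row_mx (lsubmx (gamma b - gamma a)) 0)
  (enorm (lsubmx (gamma b - gamma a))) sg (enorm_ge0 _) _ a b a0 ab bT.
rewrite edot_blocks !lrow0 edot0r addr0 => H.
apply: le_trans (ler_norm _) (H _) => t _.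
by rewrite enorm0 expr0n mulr0 addr0.
Qed.

(** The curve is tested against its own y-increment, extended by 0 in x, so that only the term with
    [lambda] remains. *)
Lemma subunit_rsubmx T gamma M : subunit lambda T gamma -> 0 <= M ->
  (forall t, t \in `[0, T] -> lambda (lsubmx (gamma t)) <= M) ->
  forall a b, 0 <= a -> a <= b -> b <= T ->
  enorm (rsubmx (gamma b) - rsubmx (gamma a)) <= M * (b - a).
Proof.
move=> sg M0 gM a b a0 ab bT; rewrite -linearB /=.
apply: self_le; first by rewrite mulr_ge0 // subr_ge0.
have := @subunit_edot_le T gamma (row_mx 0 (rsubmx (gamma b - gamma a)))
  (enorm (rsubmx (gamma b - gamma a)) * M) sg (mulr_ge0 (enorm_ge0 _) M0)
  _ a b a0 ab bT.
rewrite edot_blocks !rrow0 edot0r add0r mulrA => H.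
apply: le_trans (ler_norm _) (H _) => t /gM tM.
rewrite enorm0 expr0n add0r -exprMn mulrC.
by rewrite ler_pXn2r ?nnegrE ?mulr_ge0 ?enorm_ge0 // ler_wpM2l ?enorm_ge0.
Qed.

Lemma subunit_lambda_le T gamma r : subunit lambda T gamma -> T < r ->
  forall t, t \in `[0, T] ->
  lambda (lsubmx (gamma t)) <= Lambda lambda (gamma 0) r.
Proof.
move=> sg Tr t; rewrite in_itv /= => /andP[t0 tT]; apply: le_Lambda => //.
apply: (le_lt_trans (subunit_lsubmx sg (lexx 0) t0 tT)).
by rewrite subr0 (le_lt_trans tT).
Qed.

(** The durations of which [rho] is the infimum; working with them avoids extended reals. *)
Definition reach z w T :=
  0 <= T /\ exists gamma, [/\ subunit lambda T gamma, gamma 0 = z & gamma T = w].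

(** The y-part moves by at most [T] times [Lambda]; positivity of [Lambda] is what makes the second
    inequality strict. *)
Lemma reach_Qbox z w T r : reach z w T -> T < r -> 0 < Lambda lambda z r ->
  Qbox lambda z r w.
Proof.
move=> [T0 [gamma [sg <- <-]]] Tr L0; split.
  apply: (le_lt_trans (subunit_lsubmx sg (lexx 0) T0 (lexx T))).
  by rewrite subr0.
apply: (le_lt_trans (subunit_rsubmx sg (ltW L0) (subunit_lambda_le sg Tr)
  (lexx 0) T0 (lexx T))).
by rewrite subr0 mulrC ltr_pM2r.
Qed.

Lemma lipschitz_abs_continuous T gamma K : 0 <= K ->
  (forall a b, 0 <= a -> a <= b -> b <= T ->
     enorm (gamma b - gamma a) <= K * (b - a)) ->
  abs_continuous T gamma.
Proof.
move=> K0 lip e e0; exists (e / (K + 1)); first by rewrite divr_gt0 //; lra.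
move=> p s t st _; rewrite ltr_pdivlMr; last by lra.
apply: le_lt_trans; rewrite mulr_suml; apply: ler_sum => i _.
have [si sti ti] := st i.
apply: (le_trans (lip _ _ si (ltW sti) ti)); rewrite mulrC ler_wpM2l //; lra.
Qed.

(** Lipschitz bounds are easier to glue than absolute continuity itself. The x-part stays within [T]
    of its start, so [lambda] is bounded along the curve. *)
Lemma subunit_lipschitz T gamma : subunit lambda T gamma ->
  exists2 K, 0 <= K & forall a b, 0 <= a -> a <= b -> b <= T ->
     enorm (gamma b - gamma a) <= K * (b - a).
Proof.
move=> sg; have [T0|T0] := ltP T 0.
  by exists 0 => // a b *; exfalso; lra.
pose M := Lambda lambda (gamma 0) (T + 1).
have M0 : 0 <= M.
  apply: le_trans (lambda_ge0 (lsubmx (gamma 0))) _; apply: le_Lambda => //.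
  by rewrite subrr enorm0; lra.
exists (1 + M); first by lra.
move=> a b a0 ab bT; apply: (le_trans (enorm_blocks _)); rewrite !linearB /=.
rewrite mulrDl mul1r lerD ?(subunit_lsubmx sg) // (subunit_rsubmx sg) //.
by apply: subunit_lambda_le => //; lra.
Qed.

Lemma reach_refl z : reach z z 0.
Proof.
split => //; exists (fun=> z); split => //; split.
  by apply: (lipschitz_abs_continuous (lexx 0)) => *; rewrite subrr enorm0 mul0r.
move=> zeta; apply: aeW => t _; split; first exact: derivable_cst.
rewrite derive_cst edot0l expr0n /= addr_ge0 ?sqr_ge0 //.
by apply: mulr_ge0; exact: sqr_ge0.
Qed.

(** The curve is prolonged by a segment run with velocity [p] for time [tau]; the last hypothesis
    says that this segment is subunit. *)
Lemma reach_segment z w p T tau : reach z w T -> 0 <= tau ->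
  (forall t zeta, 0 <= t <= tau -> edot p zeta ^+ 2 <= enorm (lsubmx zeta) ^+ 2 +
    lambda (lsubmx w + t *: lsubmx p) ^+ 2 * enorm (rsubmx zeta) ^+ 2) ->
  reach z (w + tau *: p) (T + tau).
Proof.
move=> [T0 [gamma [sg g0 gT]]] tau0 Hp; split; first exact: addr_ge0.
pose delta t := if t <= T then gamma t else w + (t - T) *: p.
exists delta; split; last 2 first.
- by rewrite /delta T0.
- rewrite /delta; case: ifPn => [TT|_]; last by rewrite [T + tau]addrC addrK.
  have -> : tau = 0 by lra.
  by rewrite addr0 scale0r addr0.
have dl t : t <= T -> delta t = gamma t by rewrite /delta => ->.
have dr t : T <= t -> delta t = w + (t - T) *: p.
  rewrite /delta le_eqVlt => /predU1P[<-|]; last by rewrite ltNge => /negbTE->.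
  by rewrite lexx subrr scale0r addr0.
have [K K0 lip] := subunit_lipschitz sg.
have lipr a b : T <= a -> a <= b -> enorm (delta b - delta a) <= enorm p * (b - a).
  move=> Ta ab; rewrite !dr ?(le_trans Ta) // opprD addrACA subrr add0r -scalerBl.
  by rewrite opprB addrA subrK enormZ ger0_norm ?subr_ge0 // mulrC.
split.
  apply: (@lipschitz_abs_continuous _ _ (K + enorm p)).
    by rewrite addr_ge0 // enorm_ge0.
  move=> a b a0 ab _; have p0 := enorm_ge0 p.
  have [bT|Tb] := leP b T.
    rewrite !dl ?(le_trans ab) //; apply: (le_trans (lip _ _ a0 ab bT)).
    by rewrite ler_wpM2r ?subr_ge0 // lerDl.
  have [aT|Ta] := leP a T; last first.
    apply: (le_trans (lipr _ _ (ltW Ta) ab)).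
    by rewrite ler_wpM2r ?subr_ge0 // lerDr.
  apply: (le_trans (ler_enormB _ (delta T) _)).
  have := lipr T b (lexx T) (ltW Tb); have := lip a T a0 aT (lexx T).
  by rewrite (dl T) // (dl a) //; nra.
move=> zeta.
(* At the junction [T] the one-sided derivatives may differ, so this point joins the null set. *)
have : {ae lebesgue_measure, forall t : R, t != T}.
  exists [set T]; split => //; first by rewrite lebesgue_measure_set1.
  by move=> t /= /negP; rewrite negbK => /eqP.
have := sg.2 zeta.
apply: (@filterS2 _ _ (ae_filter_ringOfSetsType lebesgue_measure)) => t gt tT.
rewrite in_itv /= => /andP[t0 tTt].
have [{}tT|Tt|/eqP] := ltgtP t T; last by rewrite (negbTE tT).
  have tg : {near t, gamma =1 delta}.
    by near=> y; rewrite dl //; apply/ltW; near: y; exact: lt_nbhsl.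
  have [|dg gz] := gt; first by rewrite in_itv /= t0 ltW.
  split; first exact: near_eq_derivable dg.
  by rewrite -(near_eq_derive _ tg) dl ?(ltW tT).
have tg : {near t, (fun y => w + (y - T) *: p) =1 delta}.
  by near=> y; rewrite dr //; apply/ltW; near: y; exact: lt_nbhsr.
have aff : is_derive t (1 : R) (fun y : R => w + (y - T) *: p) p.
  have cvp : h^-1 *: (((fun y => w + (y - T) *: p) \o shift t) (h *: 1) -
      (w + (t - T) *: p)) @[h --> 0^'] --> p.
    apply: cvg_near_cst; rewrite near_withinE; near=> h => /= h0.
    rewrite opprD addrACA subrr add0r -scalerBl scalerA.
    have -> : h *: 1 + t - T - (t - T) = h by rewrite /GRing.scale /= mulr1; lra.
    by rewrite mulVf ?scale1r.
  by apply: DeriveDef; [apply: cvgP cvp|exact: cvg_lim cvp].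
split; first by apply: near_eq_derivable tg _; case: aff.
rewrite -(near_eq_derive _ tg) derive_val dr ?(ltW Tt) // linearD linearZ /=.
by apply: Hp; rewrite subr_ge0 (ltW Tt) lerBlDl.
Unshelve. all: by end_near. Qed.

End subunit_curves.

(** * Balls of the metric rho *)

Section rho_balls.
Context {R : realType} {n m : nat}.
Variable lambda : 'rV[R]_n -> R.
Hypothesis lambda_ge0 : forall x, 0 <= lambda x.
Hypothesis lambda_cont : continuous lambda.
Implicit Types (z w p : 'rV[R]_(n + m)).

(** A velocity of norm at most 1 in the x-directions is subunit whatever the values of [lambda]. *)
Lemma reach_lsegment z w (x : 'rV[R]_n) (T tau : R) :
  reach lambda z w T -> 0 < tau ->
  enorm (x - lsubmx w) <= tau ->
  reach lambda z (row_mx x (rsubmx w)) (T + tau).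
Proof.
move=> zw tau0 xw.
pose p : 'rV[R]_(n + m) := row_mx (tau^-1 *: (x - lsubmx w)) 0.
have -> : row_mx x (rsubmx w) = w + tau *: p.
  rewrite -{2}[w]hsubmxK scale_row_mx add_row_mx scaler0 addr0 scalerA.
  by rewrite divff ?gt_eqF // scale1r addrC subrK.
apply: reach_segment => //; first exact: ltW.
move=> t zeta _; rewrite edot_blocks row_mxKl row_mxKr edot0l addr0.
apply: (@le_trans _ _ (enorm (lsubmx zeta) ^+ 2)); last first.
  by rewrite lerDl mulr_ge0 // sqr_ge0.
rewrite -real_normK ?num_real // ler_pXn2r ?nnegrE ?enorm_ge0 //.
apply: (le_trans (edot_le_enorm _ _)); rewrite ler_piMl ?enorm_ge0 // enormZ.
by rewrite ger0_norm ?invr_ge0 ?(ltW tau0) // mulrC ler_pdivrMr // mul1r.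
Qed.

(** Along a segment in y the x-part is constant, so the speed [lambda (lsubmx w)] is allowed
    throughout. *)
Lemma reach_rsegment z w (y : 'rV[R]_m) (T tau : R) :
  reach lambda z w T -> 0 < tau ->
  enorm (y - rsubmx w) <= tau * lambda (lsubmx w) ->
  reach lambda z (row_mx (lsubmx w) y) (T + tau).
Proof.
move=> zw tau0 yw.
pose p : 'rV[R]_(n + m) := row_mx 0 (tau^-1 *: (y - rsubmx w)).
have -> : row_mx (lsubmx w) y = w + tau *: p.
  rewrite -{2}[w]hsubmxK scale_row_mx add_row_mx scaler0 addr0 scalerA.
  by rewrite divff ?gt_eqF // scale1r [rsubmx w + _]addrC subrK.
apply: reach_segment => //; first exact: ltW.
move=> t zeta _; rewrite edot_blocks row_mxKl row_mxKr edot0l add0r scaler0 addr0.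
apply: (@le_trans _ _ ((lambda (lsubmx w) * enorm (rsubmx zeta)) ^+ 2)); last first.
  by rewrite exprMn lerDr sqr_ge0.
rewrite -real_normK ?num_real // ler_pXn2r ?nnegrE ?mulr_ge0 ?enorm_ge0 //.
apply: (le_trans (edot_le_enorm _ _)); rewrite ler_wpM2r ?enorm_ge0 // enormZ.
by rewrite ger0_norm ?invr_ge0 ?(ltW tau0) // mulrC ler_pdivrMr // mulrC.
Qed.

(* Move in x to a point where lambda is nearly maximal, then in y, then in x
   again. *)
Lemma Qbox_reach z u w r T : 0 < r -> reach lambda z u T ->
  Qbox lambda u r w -> reach lambda z w (T + 4 * r).
Proof.
move=> r0 zu [xr yr].
(* The supremum need not be attained, but it strictly exceeds the required speed, and hence so does
   some value of [lambda]. *)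
have [_ [x1 x1r <-] yx1] : exists2 l, [set lambda x | x in eball (lsubmx u) r] l &
    enorm (rsubmx w - rsubmx u) / r < l.
  apply: sup_gt; last by rewrite ltr_pdivrMr // mulrC.
  by case: (@has_sup_eball _ _ _ lambda_cont (lsubmx u) r r0).
have zu1 := reach_lsegment zu r0 (ltW x1r).
have zu2 : reach lambda z (row_mx x1 (rsubmx w)) (T + r + r).
  rewrite -{1}[x1](row_mxKl x1 (rsubmx u)); apply: reach_rsegment => //.
  by rewrite row_mxKl row_mxKr mulrC -ler_pdivrMr // ltW.
(* Time [r] to reach [x1], time [r] for the move in y, and [2 * r] for the last move, as [x1] and
   the x-part of [w] are both within [r] of the x-part of [u]. *)
have -> : T + 4 * r = T + r + r + 2 * r by lra.
rewrite -[w]hsubmxK -{1}(row_mxKr x1 (rsubmx w)).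
apply: reach_lsegment => //; first by lra.
rewrite row_mxKl (le_trans (ler_enormB _ (lsubmx u) _)) //.
by move: x1r; rewrite /eball /= (enormB (lsubmx u) x1); lra.
Qed.

Lemma rho_ballP z w r :
  rho_ball lambda z r w <-> exists2 T, T < r & reach lambda z w T.
Proof.
split=> [/ereal_inf_lt[_ [T [T0 zw] <-]]|[T Tr zw]].
  by rewrite lte_fin; exists T.
rewrite /rho_ball /=; apply: (@le_lt_trans _ _ T%:E); last by rewrite lte_fin.
by apply: ereal_inf_lbound; exists T.
Qed.

(** The curve takes time [4 * r]; the factor 8 leaves room for the strict inequality that defines
    the ball. *)
Lemma Qbox_sub_rho_ball z r : 0 < r ->
  Qbox lambda z r `<=` rho_ball lambda z (8 * r).
Proof.
move=> r0 w zw; apply/rho_ballP; exists (0 + 4 * r); first by lra.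
exact: Qbox_reach (reach_refl _ _) zw.
Qed.

Hypothesis n_gt0 : (0 < n)%N.
Hypothesis lambda_isolated :
  [set x | lambda x = 0] `<=` isolated [set x | lambda x = 0].

Lemma rho_ball_sub_Qbox z r : 0 < r ->
  rho_ball lambda z r `<=` Qbox lambda z r.
Proof.
move=> r0 w /rho_ballP[T Tr zw]; apply: reach_Qbox Tr _ => //.
exact: Lambda_gt0.
Qed.

(** A point reached in time [T < r] leaves time [r - T], and reaching the box of radius
    [(r - T) / 8] around it costs only half of that. *)
Lemma open_rho_ball z r : open (rho_ball lambda z r).
Proof.
rewrite openE => u /rho_ballP[T Tr zu].
have d0 : 0 < (r - T) / 8 by rewrite divr_gt0 // subr_gt0.
apply: (@filterS _ _ _ (Qbox lambda u ((r - T) / 8))).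
  move=> w uw; apply/rho_ballP; exists (T + 4 * ((r - T) / 8)); first by lra.
  exact: Qbox_reach uw.
apply: open_nbhs_nbhs; split; first exact: open_Qbox.
by apply: Qbox_center => //; exact: Lambda_gt0.
Qed.

End rho_balls.

(** * Weighted integrals *)

Section weighted_integrals.
Context {R : realType} {k : nat}.
Local Notation T := (caratheodory_type (@rV_outer R k)).
Implicit Types (w f g : 'rV[R]_k -> R) (A B E : set 'rV[R]_k).

Lemma bounded_setS A B : A `<=` B -> bounded_set B -> bounded_set A.
Proof.
move=> AB [M [rM MB]]; exists M; split => // x Mx y /AB; exact: MB.
Qed.

Lemma wmeas_ge0 w A : weight w -> 0 <= wmeas w A.
Proof. by move=> [w0 _ _ _]; apply: Rintegral_ge0 => x _. Qed.

(** [fine] sends +oo to 0, so real-valued integrals are monotone only if the larger one is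
    finite. *)
Lemma le_rV_integral_lty A B f g : A `<=` B ->
  (forall x, A x -> 0 <= f x) -> (forall x, B x -> 0 <= g x) ->
  (forall x, A x -> f x <= g x) ->
  (\int[rV_lebesgue k]_(x in B) (g x)%:E < +oo)%E ->
  rV_integral A f <= rV_integral B g.
Proof.
move=> AB f0 g0 fg gy.
have ABle : (\int[rV_lebesgue k]_(x in A) (f x)%:E <=
    \int[rV_lebesgue k]_(x in B) (g x)%:E)%E.
  by apply: le_integral_nonmeas => // x; rewrite lee_fin; auto.
apply: fine_le => //; rewrite ge0_fin_numE ?(le_lt_trans ABle) //.
- by apply: integral_ge0 => x Ax; rewrite lee_fin f0.
- by apply: integral_ge0 => x Ax; rewrite lee_fin g0.
Qed.

Lemma le_rV_integral A B f g : A `<=` B ->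
  (forall x, A x -> 0 <= f x) -> (forall x, B x -> 0 <= g x) ->
  (forall x, A x -> f x <= g x) -> measurable (B : set T) ->
  (rV_lebesgue k).-integrable B (EFin \o g) ->
  rV_integral A f <= rV_integral B g.
Proof.
move=> AB f0 g0 fg mB ig; apply: le_rV_integral_lty => //.
by rewrite ltey_eq (integrable_fin_num mB ig).
Qed.

Lemma weight_integrable1 w E : weight w -> measurable (E : set T) ->
  bounded_set E -> (rV_lebesgue k).-integrable E (EFin \o w).
Proof.
move=> ww mE bE; have := @weight_integrable R k w (fun=> 1) E ww mE bE.
have b1 : [bounded (1 : R) | x in E].
  by exists 1; split; [exact: num_real|move=> M M1 x _ /=; rewrite normr1 ltW].
move=> /(_ (@measurable_cst _ _ _ _ _ _) b1).
by apply: eq_integrable => // x _ /=; rewrite mul1r.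
Qed.

Lemma le_wmeas w A B : weight w -> A `<=` B -> measurable (B : set T) ->
  bounded_set B -> wmeas w A <= wmeas w B.
Proof.
move=> ww AB mB bB; have [w0 _ _ _] := ww.
by apply: le_rV_integral => //; exact: weight_integrable1.
Qed.

Let bigcup_seq_nil (I : eqType) (F : I -> set 'rV[R]_k) :
  \bigcup_(j in [set` Nil I]) F j = set0.
Proof. by rewrite -subset0 => x []. Qed.

Let bigcup_seq_cons (I : eqType) (i : I) s (F : I -> set 'rV[R]_k) :
  \bigcup_(j in [set` i :: s]) F j = F i `|` \bigcup_(j in [set` s]) F j.
Proof.
apply/seteqP; split=> [x [j /=]|x [Fx|[j js Fx]]].
- by rewrite inE => /predU1P[->|js] Fx; [left|right; exists j].
- by exists i; rewrite //= mem_head.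
- by exists j; rewrite //= inE js orbT.
Qed.

Lemma rV_integral_cover (I : eqType) (s : seq I) (F : I -> set 'rV[R]_k) f A c :
  (forall x, 0 <= f x) -> measurable_fun setT (f : T -> R) ->
  (forall i, i \in s -> measurable (F i : set T)) ->
  A `<=` \bigcup_(i in [set` s]) F i ->
  (forall i, i \in s -> (rV_lebesgue k).-integrable (F i) (EFin \o f) /\
                       rV_integral (F i) f <= c) ->
  rV_integral A f <= (size s)%:R * c.
Proof.
move=> f0 mf mF AF Fc.
(* The induction makes the union disjoint, as [F i] and the rest minus [F i], and bounds an extended
   real integral. [A], possibly nonmeasurable, is compared with the union only afterwards. *)
have H : measurable (\bigcup_(i in [set` s]) F i : set T) /\
    (\int[rV_lebesgue k]_(x in \bigcup_(i in [set` s]) F i) (f x)%:E <=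
     ((size s)%:R * c)%:E)%E.
  elim: s mF {AF} Fc => [|i s IH] mF Fc.
    rewrite bigcup_seq_nil mul0r integral_set0; split => //; exact: measurable0.
  have [||mU Uc] := IH.
  - by move=> j js; apply: mF; rewrite inE js orbT.
  - by move=> j js; apply: Fc; rewrite inE js orbT.
  have -> : \bigcup_(j in [set` i :: s]) F j =
      F i `|` (\bigcup_(j in [set` s]) F j `\` F i).
    by rewrite bigcup_seq_cons setUDr setDv setD0.
  have mFi : measurable (F i : set T) by apply: mF; rewrite mem_head.
  have [iFi Fic] := Fc i (mem_head _ _).
  split; first by apply: measurableU => //; apply: measurableD.
  rewrite ge0_integral_setU //; first last.
  - by apply/disj_setPS => x [? []].
  - by move=> x _; rewrite lee_fin.
  - by apply/measurable_EFinP; exact: measurable_funTS.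
  - exact: measurableD.
  rewrite mulrS mulrDl mul1r EFinD leeD //.
    by rewrite -(fineK (integrable_fin_num mFi iFi)) lee_fin.
  apply: le_trans Uc; apply: le_integral_nonmeas => // x; rewrite ?lee_fin //.
have [mU Uc] := H.
have Ac : (\int[rV_lebesgue k]_(x in A) (f x)%:E <= ((size s)%:R * c)%:E)%E.
  by apply: le_trans Uc; apply: le_integral_nonmeas => // x; rewrite ?lee_fin.
rewrite -lee_fin fineK // ge0_fin_numE ?(le_lt_trans Ac) ?ltry //.
by apply: integral_ge0 => x _; rewrite lee_fin.
Qed.

(** Additivity on disjoint sets; this is the packing bound for the number of boxes. *)
Lemma wmeas_disjoint (I : eqType) (s : seq I) (F : I -> set 'rV[R]_k) w B c :
  weight w -> measurable (B : set T) -> bounded_set B ->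
  (forall i, i \in s -> measurable (F i : set T) /\ F i `<=` B) ->
  pairwise (fun i j => `[< F i `&` F j = set0 >]) s ->
  (forall i, i \in s -> c <= wmeas w (F i)) ->
  (size s)%:R * c <= wmeas w B.
Proof.
move=> ww mB bB mF dF Fc.
have [w0 _ mw _] := ww.
pose U (s : seq I) := \bigcup_(i in [set` s]) F i.
suff [mU [UB Uc]] : measurable (U s : set T) /\ (U s `<=` B /\
    (size s)%:R * c <= wmeas w (U s)).
  exact: le_trans Uc (le_wmeas ww UB mB bB).
elim: s mF dF Fc => [|i s IH] mF dF Fc.
  rewrite /U bigcup_seq_nil mul0r; split; first exact: measurable0.
  by split => //; rewrite wmeas_ge0.
move: dF; rewrite pairwise_cons => /andP[/allP is_ ds].
have [||mU [UB Uc]] := IH _ ds.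
- by move=> j js; apply: mF; rewrite inE js orbT.
- by move=> j js; apply: Fc; rewrite inE js orbT.
have [mFi FiB] := mF i (mem_head _ _).
have UE : U (i :: s) = F i `|` U s by rewrite /U bigcup_seq_cons.
have UUB : U (i :: s) `<=` B by rewrite UE subUset.
rewrite UE; split; first exact: measurableU.
split; first by rewrite -UE.
rewrite /= mulrS mulrDl mul1r /wmeas /rV_integral Rintegral_setU //.
- by rewrite lerD // Fc // mem_head.
- rewrite -UE; apply: weight_integrable1 => //; last exact: bounded_setS bB.
  by rewrite UE; exact: measurableU.
- apply/disj_setPS => x [Fix [j js Fjx]].
  by have /asboolP <- := is_ j js.
Qed.

End weighted_integrals.

(** * Lipschitz functions *)

Section lipschitz_functions.
Context {R : realType} {k : nat}.
Implicit Types (g : 'rV[R]_k -> R).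

Lemma lipschitz_dist g : lipschitz g ->
  exists2 L, 0 < L & forall x y, `|g x - g y| <= L * `|x - y|.
Proof.
move=> /pinfty_ex_gt0[L L0 gL]; exists L => // x y.
by apply: (gL (x, y)).
Qed.

Lemma lipschitz_continuous g : lipschitz g -> continuous g.
Proof.
move=> /lipschitz_dist[L L0 gL] x A /nbhs_ballP[e /= e0 eA].
have eL : 0 < e / L by rewrite divr_gt0.
apply/nbhs_ballP; exists (e / L) => // y; rewrite -ball_normE /= => xy.
by apply: eA; rewrite -ball_normE /= (le_lt_trans (gL x y)) // mulrC -ltr_pdivlMr.
Qed.

Lemma lipschitz_bounded g (A : set 'rV[R]_k) : lipschitz g -> bounded_set A ->
  exists M, forall x, A x -> `|g x| <= M.
Proof.
move=> /lipschitz_dist[L L0 gL] [N [_ AN]]; exists (`|g 0| + L * (N + 1)) => x Ax.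
rewrite -[g x](subrK (g 0)) addrC (le_trans (ler_normD _ _)) // lerD2l.
by rewrite (le_trans (gL _ _)) // ler_wpM2l ?(ltW L0) // subr0 AN ?ltrDl.
Qed.

Lemma lipschitz_derive g v : lipschitz g ->
  exists M, forall x, `|'D_v g x| <= M.
Proof.
(* The second summand covers the points without a derivative, where ['D_v g x] is the default value
   [point]. *)
move=> /lipschitz_dist[L L0 gL]; exists (L * `|v| + `|point : R|) => x.
have [dg|ndg] := pselect (derivable g x v); last first.
  by rewrite /derive dvgP // lerDr mulr_ge0 // ltW.
apply: (@le_trans _ _ (L * `|v|)); last by rewrite lerDl.
have : `|h^-1 *: (g (h *: v + x) - g x)| @[h --> 0^'] --> `|'D_v g x|.
  exact: (cvg_comp _ _ dg (@norm_continuous _ _ ('D_v g x))).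
move=> /cvgr_to_le; apply; rewrite near_withinE; near=> h => h0.
rewrite normrM normfV ler_pdivrMl ?normr_gt0 // mulrCA -normrZ.
by rewrite (le_trans (gL _ _)) // addrK.
Unshelve. all: by end_near. Qed.

End lipschitz_functions.

Lemma powR_addr_le (R : realType) (a b q : R) : 0 <= q ->
  `|a + b| `^ q <= 2 `^ q * (`|a| `^ q + `|b| `^ q).
Proof.
move=> q0; wlog ba : a b / `|b| <= `|a|.
  move=> H; case: (leP `|b| `|a|) => [|/ltW]; first exact: H.
  by move=> /H; rewrite addrC [X in _ * X]addrC.
apply: (@le_trans _ _ ((2 * `|a|) `^ q)).
  rewrite ge0_ler_powR ?nnegrE ?mulr_ge0 //.
  by rewrite (le_trans (ler_normD _ _)) //; lra.
by rewrite powRM // ler_wpM2l ?powR_ge0 // lerDl powR_ge0.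
Qed.

(** * Means and powers of Lipschitz functions against a weight *)

Section weighted_means.
Context {R : realType} {k : nat}.
Local Notation T := (caratheodory_type (@rV_outer R k)).
Variables (w g : 'rV[R]_k -> R) (B : set 'rV[R]_k).
Hypotheses (ww : weight w) (mB : measurable (B : set T)) (bB : bounded_set B).
Hypothesis g_lip : lipschitz g.

Lemma measurable_powR_dist (q c : R) :
  measurable_fun setT ((fun z => `|g z - c| `^ q) : T -> R).
Proof.
have mg : measurable_fun setT (g : T -> R).
  exact/continuous_measurable_rV/lipschitz_continuous.
have mgc : measurable_fun setT (fun z : T => `|g z - c|).
  apply: (@measurableT_comp _ _ _ _ _ _ (@Num.norm _ R)) => //.
  exact: measurable_funB.
exact: (measurableT_comp (measurable_powR q) mgc).
Qed.

Lemma integrable_powR (q c : R) : 0 <= q ->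
  (rV_lebesgue k).-integrable B (EFin \o (fun z => `|g z - c| `^ q * w z)).
Proof.
move=> q0; apply: weight_integrable => //; first exact: measurable_powR_dist.
have [M gM] := lipschitz_bounded g_lip bB.
exists ((M + `|c|) `^ q); split; first exact: num_real.
move=> N MN x Bx /=; rewrite ger0_norm ?powR_ge0 // (le_trans _ (ltW MN)) //.
have M0 : 0 <= M + `|c| by rewrite addr_ge0 // (le_trans _ (gM _ Bx)).
rewrite ge0_ler_powR ?nnegrE //.
by rewrite (le_trans (ler_normB _ _)) // lerD2r gM.
Qed.

Lemma integrable_expr (j : nat) :
  (rV_lebesgue k).-integrable B (EFin \o (fun z => g z ^+ j * w z)).
Proof.
apply: weight_integrable => //.
  apply: measurable_funX.
  exact/continuous_measurable_rV/lipschitz_continuous.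
have [M gM] := lipschitz_bounded g_lip bB.
exists (M ^+ j); split; first exact: num_real.
move=> N MN x Bx /=; rewrite normrX (le_trans _ (ltW MN)) //.
by rewrite lerXn2r ?nnegrE ?gM // (le_trans _ (gM _ Bx)).
Qed.

Let integrable_scale (c : R) (f : 'rV[R]_k -> R) :
  (rV_lebesgue k).-integrable B (EFin \o f) ->
  (rV_lebesgue k).-integrable B (EFin \o (fun z => c * f z)).
Proof. exact: (@integrableZl _ _ _ _ _ mB c (EFin \o f)). Qed.

(** Cauchy-Schwarz for the mean m, in the form that the integral of (g - m)^2 w is nonnegative. *)
Lemma sqr_wmean_le : 0 < wmeas w B ->
  wmean w B g ^+ 2 <= (wmeas w B)^-1 * rV_integral B (fun z => g z ^+ 2 * w z).
Proof.
move=> B0; set m := wmean w B g; have [w0 _ _ _] := ww.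
have int1 := integrable_expr 1; have int2 := integrable_expr 2.
have int0 := weight_integrable1 ww mB bB.
have I1 : rV_integral B (fun z => g z ^+ 1 * w z) = m * wmeas w B.
  by rewrite /m /wmean mulrAC mulVf ?gt_eqF // mul1r.
have : 0 <= rV_integral B (fun z => (g z - m) ^+ 2 * w z).
  by apply: Rintegral_ge0 => z _; rewrite mulr_ge0 ?sqr_ge0.
have -> : rV_integral B (fun z => (g z - m) ^+ 2 * w z) = rV_integral B (fun z =>
    g z ^+ 2 * w z + ((- (2 * m)) * (g z ^+ 1 * w z) + m ^+ 2 * w z)).
  by apply: eq_Rintegral => z _; ring.
have intm0 := integrable_scale (m ^+ 2) int0.
have intm1 := integrable_scale (- (2 * m)) int1.
rewrite /rV_integral RintegralD //; last exact: integrableD intm1 intm0.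
rewrite RintegralD // !RintegralZl //.
rewrite -![Rintegral _ _ _]/(rV_integral _ _) I1 -/(wmeas w B).
by rewrite ler_pdivlMl //; lra.
Qed.

(** Splits [g] into its oscillation, to be bounded by the Sobolev-Poincare inequality, and its mean,
    to be bounded by [sqr_wmean_le]. *)
Lemma powR_integral_le (q : R) : 0 < q ->
  rV_integral B (fun z => `|g z| `^ q * w z) <= 2 `^ q *
    (rV_integral B (fun z => `|g z - wmean w B g| `^ q * w z) +
     `|wmean w B g| `^ q * wmeas w B).
Proof.
move=> q0; set m := wmean w B g; have [w0 _ _ _] := ww.
have intm := integrable_powR m (ltW q0).
have int0 := weight_integrable1 ww mB bB.
have intm0 := integrable_scale (`|m| `^ q) int0.
have intD := integrableD mB intm intm0.
apply: (@le_trans _ _ (rV_integral B (fun z =>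
    2 `^ q * (`|g z - m| `^ q * w z + `|m| `^ q * w z)))).
  apply: le_rV_integral => // [x _|x _|x _|].
  - by rewrite mulr_ge0 ?powR_ge0.
  - by rewrite mulr_ge0 ?addr_ge0 ?mulr_ge0 ?powR_ge0.
  - by rewrite -mulrDl mulrA ler_wpM2r // -{1}(subrK m (g x)) powR_addr_le // ltW.
  - exact: integrable_scale intD.
rewrite /rV_integral RintegralZl // RintegralD // RintegralZl //.
Qed.

End weighted_means.

(** * Doubling weights *)

Section doubling_weights.
Context {R : realType} {n m : nat}.
Local Notation T := (caratheodory_type (@rV_outer R (n + m))).
Variable lambda : 'rV[R]_n -> R.
Hypothesis lambda_ge0 : forall x, 0 <= lambda x.
Hypothesis lambda_cont : continuous lambda.
Hypothesis n_gt0 : (0 < n)%N.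
Hypothesis lambda_isolated :
  [set x | lambda x = 0] `<=` isolated [set x | lambda x = 0].
Implicit Types (z : 'rV[R]_(n + m)) (w g : 'rV[R]_(n + m) -> R).

Lemma measurable_Qbox z r : measurable (Qbox lambda z r : set T).
Proof. exact/open_measurable_rV/open_Qbox. Qed.

Lemma measurable_rho_ball z r : measurable (rho_ball lambda z r : set T).
Proof. exact/open_measurable_rV/open_rho_ball. Qed.

Lemma rho_ball_subset z r r' : r <= r' ->
  rho_ball lambda z r `<=` rho_ball lambda z r'.
Proof.
by move=> rr' w; rewrite /rho_ball /= => /lt_le_trans; apply; rewrite lee_fin.
Qed.

Lemma bounded_rho_ball z r : 0 < r -> bounded_set (rho_ball lambda z r).
Proof.
move=> r0; apply: bounded_setS (bounded_Qbox lambda z r).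
exact: rho_ball_sub_Qbox.
Qed.

(** Doubling iterated [k] times; the constant [D] can be shared by both weights. *)
Lemma wmeas_dilate w C D z r r' (k : nat) : weight w ->
  rho_doubling lambda C w -> C <= D -> 0 <= D -> 0 < r -> r' <= 2 ^+ k * r ->
  wmeas w (rho_ball lambda z r') <= D ^+ k * wmeas w (rho_ball lambda z r).
Proof.
move=> ww dw CD D0 r0 r'k.
have pr j : 0 < 2 ^+ j * r by rewrite mulr_gt0 // exprn_gt0.
apply: (@le_trans _ _ (wmeas w (rho_ball lambda z (2 ^+ k * r)))).
  apply: le_wmeas => //; first exact: rho_ball_subset.
    exact: measurable_rho_ball.
  exact: bounded_rho_ball.
elim: k {r'k} => [|k IH]; first by rewrite !expr0 !mul1r.
rewrite exprS -mulrA (le_trans (dw _ _ (pr k))) // exprS -mulrA.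
apply: (le_trans (ler_wpM2r (wmeas_ge0 _ ww) CD)).
by rewrite ler_wpM2l.
Qed.

(* A maximal family of disjoint boxes Q(z, d) with centers in A. *)
Lemma Qbox_cover w (A B : set 'rV[R]_(n + m)) (d K : R) : weight w -> 0 < d ->
  measurable (B : set T) -> bounded_set B -> 0 < K -> 0 < wmeas w B ->
  (forall z, A z -> Qbox lambda z d `<=` B /\
                    wmeas w B <= K * wmeas w (Qbox lambda z d)) ->
  exists s : seq 'rV[R]_(n + m), [/\ forall z, z \in s -> A z, (size s)%:R <= K &
    A `<=` \bigcup_(z in [set` s]) Qbox lambda z (3 * d)].
Proof.
move=> ww d0 mB bB K0 B0 AB.
pose disj z z' := `[< Qbox lambda z d `&` Qbox lambda z' d = set0 >].
pose P N := `[< exists s, [/\ size s = N, forall z, z \in s -> A z &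
  pairwise disj s] >].
have P0 : exists N, P N by exists 0%N; apply/asboolP; exists [::].
(* Each box lies in [B] and has at least the mass of [B] divided by [K], so at most [K] disjoint
   ones fit, and a largest family exists. *)
have PK N : P N -> N%:R <= K.
  move=> /asboolP[s [<- sA sd]].
  rewrite -[leRHS]mul1r -ler_pdivrMr //.
  have : (size s)%:R * (wmeas w B / K) <= wmeas w B.
    apply: (@wmeas_disjoint _ _ _ s (fun z => Qbox lambda z d)) => // z /sA Az.
      by split; [exact: measurable_Qbox|case: (AB z Az)].
    by rewrite ler_pdivrMr // mulrC; case: (AB z Az).
  by rewrite mulrCA -[leRHS]mulr1 ler_pM2l.
have Pb N : P N -> (N <= Num.bound K)%N.
  move=> /PK NK; rewrite ltnW // -(@ltr_nat R) (le_lt_trans NK) //.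
  exact: archi_boundP (ltW K0).
case: (ex_maxnP P0 Pb) => N PN Nmax; have := PN => /asboolP[s [sN sA sd]].
exists s; split => //; first by rewrite sN PK.
move=> z Az; apply: contrapT => nz.
(* By [Qbox_meet], the box of a point outside all the tripled boxes is disjoint from the family,
   which could then be enlarged. *)
have : P N.+1.
  apply/asboolP; exists (z :: s); split => //=; first by rewrite sN.
    by move=> z'; rewrite inE => /predU1P[->|/sA].
  rewrite sd andbT; apply/allP => z' sz'; apply/asboolP.
  apply: contrapT => /eqP/set0P zz'; apply: nz; exists z' => //.
  by apply: Qbox_meet => //; rewrite setIC.
by move=> /Nmax; rewrite ltnn.
Qed.

Lemma grad_bounded g (E : set 'rV[R]_(n + m)) M : lipschitz g ->
  (forall z, E z -> lambda (lsubmx z) <= M) ->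
  exists2 C, 0 <= C & forall z, E z -> enorm (grad lambda g z) ^+ 2 <= C.
Proof.
move=> gl EM.
have /choice[a aP] i := @lipschitz_derive _ _ g (delta_mx 0 (lshift m i)) gl.
have /choice[b bP] j := @lipschitz_derive _ _ g (delta_mx 0 (rshift n j)) gl.
exists (\sum_i a i ^+ 2 + \sum_j (M * b j) ^+ 2).
  by rewrite addr_ge0 // sumr_ge0 // => i _; rewrite sqr_ge0.
move=> z Ez; rewrite sqr_enorm edot_blocks row_mxKl row_mxKr.
apply: lerD; apply: ler_sum => i _; rewrite !mxE -expr2 -real_normK ?num_real //.
  by rewrite lerXn2r // nnegrE // (le_trans _ (aP i z)).
have bi := le_trans (normr_ge0 _) (bP i z).
have M0 := le_trans (lambda_ge0 _) (EM z Ez).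
rewrite lerXn2r ?nnegrE ?mulr_ge0 //.
by rewrite normrM ler_pM // ger0_norm ?EM.
Qed.

End doubling_weights.

(** * The estimate *)

Section square_roots.
Context {R : realType}.
Implicit Types x y c q : R.

Lemma powR_half_le x y c : 0 <= x -> 0 <= y -> 0 <= c -> x <= c * y ->
  x `^ 2^-1 <= c `^ 2^-1 * y `^ 2^-1.
Proof.
move=> x0 y0 c0 xy; rewrite -powRM // ge0_ler_powR ?nnegrE ?invr_ge0 //.
exact: mulr_ge0.
Qed.

Lemma mulr_powR_half c x : 0 <= c -> 0 <= x ->
  c * x `^ 2^-1 = (c ^+ 2 * x) `^ 2^-1.
Proof.
move=> c0 x0; rewrite powRM ?sqr_ge0 //; congr (_ * _).
by rewrite powR12_sqrt ?sqr_ge0 // sqrtr_sqr ger0_norm.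
Qed.

Lemma norm_powR_half x : `|x| = (x ^+ 2) `^ 2^-1.
Proof. by rewrite powR12_sqrt ?sqr_ge0 // sqrtr_sqr. Qed.

Lemma le_powR_inv x y q : 0 < q -> 0 <= x -> x `^ q^-1 <= y -> x <= y `^ q.
Proof.
move=> q0 x0 xy; rewrite -[leLHS]powRr1 // -(mulVf (lt0r_neq0 q0)) powRrM.
rewrite ge0_ler_powR ?nnegrE ?powR_ge0 ?(ltW q0) //.
exact: le_trans (powR_ge0 _ _) xy.
Qed.

(** Combines the bounds for the oscillation and for the mean: [a] will be the Sobolev-Poincare
    constant, [b] the mass ratio. *)
Lemma powR_sum_le a b x y q : 0 < q -> 0 <= a -> 0 <= b -> 0 <= x -> 0 <= y ->
  (a * (b `^ 2^-1 * x)) `^ q + (b `^ 2^-1 * y) `^ q <=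
  (a `^ q + 1) * b `^ (q / 2) * (x + y) `^ q.
Proof.
move=> q0 a0 b0 x0 y0; have p0 := powR_ge0 b 2^-1.
have bE : b `^ (q / 2) = (b `^ 2^-1) `^ q by rewrite mulrC powRrM.
rewrite !powRM ?mulr_ge0 // bE.
have xq : x `^ q <= (x + y) `^ q.
  by rewrite ge0_ler_powR ?nnegrE ?addr_ge0 ?(ltW q0) // lerDl.
have yq : y `^ q <= (x + y) `^ q.
  by rewrite ge0_ler_powR ?nnegrE ?addr_ge0 ?(ltW q0) // lerDr.
have bq := powR_ge0 (b `^ 2^-1) q; have aq := powR_ge0 a q.
set c := (b `^ 2^-1) `^ q in bq *.
have -> : (a `^ q + 1) * c * (x + y) `^ q =
    a `^ q * (c * (x + y) `^ q) + c * (x + y) `^ q by ring.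
by rewrite lerD // ?ler_wpM2l.
Qed.

End square_roots.

(** * The estimate on one box *)

Section local_estimate.
Context {R : realType} {n m : nat}.
Local Notation T := (caratheodory_type (@rV_outer R (n + m))).
Variable lambda : 'rV[R]_n -> R.
Hypothesis lambda_ge0 : forall x, 0 <= lambda x.
Hypothesis lambda_cont : continuous lambda.
Hypothesis n_gt0 : (0 < n)%N.
Hypothesis lambda_isolated :
  [set x | lambda x = 0] `<=` isolated [set x | lambda x = 0].
Implicit Types (z : 'rV[R]_(n + m)).
Variables (u v g : 'rV[R]_(n + m) -> R) (C3 C4 C5 q D : R).
Hypotheses (wu : weight u) (wv : weight v).
Hypotheses (du : rho_doubling lambda C3 u) (dv : rho_doubling lambda C4 v).
Hypotheses (D_gt0 : 0 < D) (C3D : C3 <= D) (C4D : C4 <= D).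
Hypotheses (q_gt2 : 2 < q) (C5_gt0 : 0 < C5).
Hypothesis sp : sobolev_poincare lambda u v q C5.
Hypothesis g_lip : lipschitz g.
Variables (z0 : 'rV[R]_(n + m)) (s e : R) (k : nat).
Hypotheses (s_gt0 : 0 < s) (e_gt0 : 0 < e) (e_lt1 : e < 1).
(* 768 = 24 * 32, and Q' lies in the ball B(z, 32 s) for every z in Q. *)
Hypothesis ke : 768 <= 2 ^+ k * e.

Let Q := Qbox lambda z0 s.
Let Q' := Qbox lambda z0 ((1 + e) * s).
(** 24 = 3 * 8: the tripling in [Qbox_cover] and the factor 8 of [Qbox_sub_rho_ball] lead from [d]
    to the radius [e * s]. *)
Let d := e * s / 24.
Let K := D ^+ k.

Lemma radius_gt0 : 0 < d. Proof. by rewrite divr_gt0 // mulr_gt0. Qed.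

Lemma dilation_gt0 : 0 < K. Proof. exact: exprn_gt0. Qed.

Lemma ball_radius_gt0 : 0 < e * s. Proof. exact: mulr_gt0. Qed.

#[local] Hint Resolve radius_gt0 dilation_gt0 ball_radius_gt0 : core.

Lemma radius_le : d <= e * s. Proof. by move: ball_radius_gt0; rewrite /d; lra. Qed.

Lemma side_le : s <= (1 + e) * s. Proof. by rewrite mulrDl mul1r lerDl ltW. Qed.

Lemma Qbox_sub_enlarged : Q `<=` Q'.
Proof. exact: (Qbox_subset lambda_ge0 lambda_cont s_gt0 side_le). Qed.

Lemma Qbox_mem_center : Q z0.
Proof. by apply: Qbox_center => //; exact: Lambda_gt0. Qed.

#[local] Hint Resolve radius_le side_le Qbox_sub_enlarged Qbox_mem_center : core.

Lemma rho_ball_sub_enlarged z : Q z -> rho_ball lambda z (e * s) `<=` Q'.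
Proof.
move=> Qz w /(rho_ball_sub_Qbox lambda_ge0 lambda_cont n_gt0 lambda_isolated
  ball_radius_gt0).
by rewrite /Q' mulrDl mul1r; exact: Qbox_sub.
Qed.

(** [Q'] lies in Q(z0, 2 s), which lies in Q(z, 4 s), which lies in B(z, 32 s); [k] doublings of the
    radius [d] reach 32 s. *)
Lemma wmeas_le_small_ball w C z : weight w -> rho_doubling lambda C w -> C <= D ->
  Q z -> wmeas w Q' <= K * wmeas w (rho_ball lambda z d).
Proof.
move=> ww dw CD Qz.
have s2 : 0 < 2 * s by rewrite mulr_gt0.
have s4 : 0 < 2 * (2 * s) by rewrite mulr_gt0.
apply: le_trans (wmeas_dilate lambda_ge0 lambda_cont n_gt0 lambda_isolated
  (r' := 8 * (2 * (2 * s))) z ww dw CD (ltW D_gt0) radius_gt0 _); last first.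
  have := ler_wpM2r (ltW s_gt0) ke; rewrite /d; lra.
apply: le_wmeas => //.
- apply: subset_trans (Qbox_sub_rho_ball lambda_ge0 lambda_cont s4).
  move=> w' Qw'; apply: (Qbox_sub2 lambda_cont s2 (z0 := z0)).
    by apply: Qbox_subset Qz => //; lra.
  apply: Qbox_subset Qw' => //; first exact: lt_le_trans side_le.
  by rewrite ler_pM2r // -[2]/(1 + 1) lerD2l ltW.
- exact: measurable_rho_ball.
- by apply: bounded_rho_ball => //; rewrite mulr_gt0.
Qed.

Lemma wmeas_le_ball w C z : weight w -> rho_doubling lambda C w -> C <= D ->
  Q z -> wmeas w Q' <= K * wmeas w (rho_ball lambda z (e * s)).
Proof.
move=> ww dw CD Qz; apply: (le_trans (wmeas_le_small_ball ww dw CD Qz)).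
rewrite ler_pM2l //; apply: le_wmeas => //; first exact: rho_ball_subset.
  exact: measurable_rho_ball.
exact: bounded_rho_ball.
Qed.

Lemma wmeas_enlarged_le w C : weight w -> rho_doubling lambda C w -> C <= D ->
  wmeas w Q' <= K * wmeas w Q.
Proof.
move=> ww dw CD; apply: (le_trans (wmeas_le_small_ball ww dw CD Qbox_mem_center)).
rewrite ler_pM2l //; apply: le_wmeas => //.
- move=> w' /(rho_ball_sub_Qbox lambda_ge0 lambda_cont n_gt0 lambda_isolated radius_gt0).
  by apply: Qbox_subset => //; apply: (le_trans radius_le); rewrite ler_piMl // ltW.
- exact: measurable_Qbox.
- exact: bounded_Qbox.
Qed.

Lemma wmeas_le_enlarged w A : weight w -> A `<=` Q' -> wmeas w A <= wmeas w Q'.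
Proof.
by move=> ww AQ'; apply: le_wmeas => //; [exact: measurable_Qbox|exact: bounded_Qbox].
Qed.

Let GQ := rV_integral Q' (fun z => enorm (grad lambda g z) ^+ 2 * v z).
Let HQ := rV_integral Q' (fun z => g z ^+ 2 * u z).

Lemma energy_ge0 : 0 <= GQ.
Proof.
by have [v0 _ _ _] := wv; apply: Rintegral_ge0 => z _; rewrite mulr_ge0 ?sqr_ge0.
Qed.

Lemma mass_ge0 : 0 <= HQ.
Proof.
by have [u0 _ _ _] := wu; apply: Rintegral_ge0 => z _; rewrite mulr_ge0 ?sqr_ge0.
Qed.

#[local] Hint Resolve energy_ge0 mass_ge0 : core.

(** The gradient is bounded on [Q'], so the integral over [Q'] is finite; monotonicity then holds
    without measurability of the gradient. *)
Lemma energy_le A : A `<=` Q' ->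
  rV_integral A (fun z => enorm (grad lambda g z) ^+ 2 * v z) <= GQ.
Proof.
move=> AQ'; have [v0 _ _ _] := wv.
have [C C0 gC] := grad_bounded lambda_ge0 g_lip
  (fun z (Qz : Q' z) => le_Lambda lambda_cont Qz.1).
have F0 z : 0 <= enorm (grad lambda g z) ^+ 2 * v z by rewrite mulr_ge0 ?sqr_ge0.
apply: le_rV_integral_lty => //.
have mQ' : measurable (Q' : set T) by exact: measurable_Qbox.
have iC : (rV_lebesgue (n + m)).-integrable Q' (EFin \o (fun z => C * v z)).
  apply: (weight_integrable (f := fun=> C)) => //; first exact: bounded_Qbox.
  by exists `|C|; split; [exact: num_real|move=> M CM x _ /=; exact: ltW].
apply: le_lt_trans (integrable_lty mQ' iC).
apply: le_integral_nonmeas => // z Qz; rewrite lee_fin //.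
- by rewrite mulr_ge0.
- by rewrite ler_wpM2r // gC.
Qed.

(** With [H] below, the bracket of the final inequality is [G + H]. *)
Let G := (s ^+ 2 / wmeas v Q * GQ) `^ 2^-1.
Let H := ((wmeas u Q)^-1 * HQ) `^ 2^-1.

(** The mass of [Q] is at most that of [Q'], hence at most [K] times that of [B]. Its positivity
    follows from that of [B] through [wmeas_enlarged_le]. *)
Lemma inv_wmeas_le w C B : weight w -> rho_doubling lambda C w -> C <= D ->
  0 < wmeas w B -> B `<=` Q' -> wmeas w Q' <= K * wmeas w B ->
  (wmeas w B)^-1 <= K / wmeas w Q.
Proof.
move=> ww dw CD B0 BQ' QB.
have wQ : 0 < wmeas w Q.
  rewrite -(pmulr_rgt0 _ dilation_gt0); apply: lt_le_trans (wmeas_enlarged_le ww dw CD).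
  exact: lt_le_trans (wmeas_le_enlarged ww BQ').
rewrite ler_pdivlMr // mulrC ler_pdivrMr //; apply: le_trans QB.
exact: wmeas_le_enlarged.
Qed.

(** The normalized oscillation is at most [C5] K^(1/2) [G], the mean at most K^(1/2) [H]; each
    factor [K] comes from replacing the mass of the ball by that of [Q]. *)
Lemma rho_ball_estimate z : 0 < wmeas u Q -> Q z ->
  rV_integral (rho_ball lambda z (e * s)) (fun z => `|g z| `^ q * u z) <=
  wmeas u Q' * (2 `^ q * (C5 `^ q + 1) * K `^ (q / 2) * (G + H) `^ q).
Proof.
move=> uQ Qz; set B := rho_ball _ _ _.
have q0 : 0 < q by exact: lt_trans q_gt2.
have BQ' : B `<=` Q' by exact: rho_ball_sub_enlarged.
have mB : measurable (B : set T) by exact: measurable_rho_ball.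
have bB : bounded_set B by exact: bounded_rho_ball.
have uB : 0 < wmeas u B.
  rewrite -(pmulr_rgt0 _ dilation_gt0); apply: lt_le_trans (wmeas_le_ball wu du C3D Qz).
  exact: lt_le_trans uQ (wmeas_le_enlarged wu Qbox_sub_enlarged).
have G0 : 0 <= G by exact: powR_ge0.
have H0 : 0 <= H by exact: powR_ge0.
set m_ := wmean u B g.
have [u0 _ _ _] := wu; have [v0 _ _ _] := wv.
have uQi : 0 <= (wmeas u Q)^-1 by rewrite invr_ge0 wmeas_ge0.
have vQi : 0 <= (wmeas v Q)^-1 by rewrite invr_ge0 wmeas_ge0.
have K0 := ltW dilation_gt0.
have Hle : `|m_| <= K `^ 2^-1 * H.
  rewrite norm_powR_half; apply: powR_half_le (sqr_ge0 _) _ K0 _.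
    exact: mulr_ge0.
  apply: (le_trans (sqr_wmean_le wu mB bB g_lip uB)).
  rewrite mulrA; apply: ler_pM; first by rewrite invr_ge0 wmeas_ge0.
  - by apply: Rintegral_ge0 => w _; rewrite mulr_ge0 ?sqr_ge0.
  - exact: inv_wmeas_le du C3D uB BQ' (wmeas_le_ball wu du C3D Qz).
  - apply: le_rV_integral => // [w _|w _||].
    + by rewrite mulr_ge0 ?sqr_ge0.
    + by rewrite mulr_ge0 ?sqr_ge0.
    + exact: measurable_Qbox.
    + by apply: integrable_expr => //; [exact: measurable_Qbox|exact: bounded_Qbox].
have Gle : ((wmeas u B)^-1 * rV_integral B (fun w => `|g w - m_| `^ q * u w))
    `^ q^-1 <= C5 * (K `^ 2^-1 * G).
  apply: (le_trans (sp z g_lip ball_radius_gt0)).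
  set I := rV_integral _ (fun w => _ * v w).
  rewrite -[leLHS]mulrA; apply: ler_wpM2l (ltW C5_gt0) _ _ _.
  (* The inverse of 0 is 0, so for a ball of v-mass 0 the Sobolev-Poincare bound itself vanishes. *)
  have [vB|vB] := eqVneq (wmeas v B) 0.
    have -> : ((wmeas v B)^-1 * I) `^ 2^-1 = 0.
      by rewrite vB invr0 mul0r powR0 // invr_neq0 // pnatr_eq0.
    by rewrite [leLHS]mulr0; apply: mulr_ge0; exact: powR_ge0.
  have {}vB : 0 < wmeas v B by rewrite lt_def vB wmeas_ge0.
  have I0 : 0 <= I by apply: Rintegral_ge0 => w _; rewrite mulr_ge0 ?sqr_ge0.
  have X0 : 0 <= (wmeas v B)^-1 * I.
    by apply: mulr_ge0 => //; rewrite invr_ge0 ltW.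
  (* The radius [e * s] is at most [s], which is then moved under the root. *)
  apply: (@le_trans _ _ (s * ((wmeas v B)^-1 * I) `^ 2^-1)).
    by rewrite ler_wpM2r ?powR_ge0 // ler_piMl // ltW.
  rewrite [leLHS](mulr_powR_half (ltW s_gt0) X0).
  apply: powR_half_le K0 _; first by apply: mulr_ge0 => //; exact: sqr_ge0.
    by apply: mulr_ge0 => //; apply: mulr_ge0 => //; exact: sqr_ge0.
  rewrite -[s ^+ 2 / _ * _]mulrA [leRHS]mulrCA; apply: ler_wpM2l (sqr_ge0 _) _ _ _.
  rewrite mulrA; apply: ler_pM => //; last exact: energy_le.
    by rewrite invr_ge0 ltW.
  exact: inv_wmeas_le dv C4D vB BQ' (wmeas_le_ball wv dv C4D Qz).
have Gq : rV_integral B (fun w => `|g w - m_| `^ q * u w) <=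
    wmeas u B * (C5 * (K `^ 2^-1 * G)) `^ q.
  rewrite -ler_pdivrMl //; apply: le_powR_inv => //.
  apply: mulr_ge0; first by rewrite invr_ge0 ltW.
  by apply: Rintegral_ge0 => w _; rewrite mulr_ge0 ?powR_ge0.
have Hq : `|m_| `^ q * wmeas u B <= wmeas u B * (K `^ 2^-1 * H) `^ q.
  rewrite mulrC ler_pM2l //; apply: ge0_ler_powR => //; first exact: ltW.
  by rewrite nnegrE; apply: mulr_ge0; exact: powR_ge0.
apply: (le_trans (powR_integral_le wu mB bB g_lip q0)).
set F := (C5 `^ q + 1) * K `^ (q / 2) * (G + H) `^ q.
have F0 : 0 <= F.
  apply: mulr_ge0 (powR_ge0 _ _); apply: mulr_ge0 (powR_ge0 _ _).
  by rewrite addr_ge0 ?powR_ge0.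
have -> : 2 `^ q * (C5 `^ q + 1) * K `^ (q / 2) * (G + H) `^ q = 2 `^ q * F.
  by rewrite /F !mulrA.
apply: (@le_trans _ _ (2 `^ q * (wmeas u B * F))); last first.
  rewrite mulrCA; apply: ler_wpM2r; last exact: wmeas_le_enlarged.
  by apply: mulr_ge0 => //; exact: powR_ge0.
apply: ler_wpM2l (powR_ge0 _ _) _ _ _; apply: (le_trans (lerD Gq Hq)).
rewrite -mulrDr; apply: ler_wpM2l (ltW uB) _ _ _.
exact: powR_sum_le q0 (ltW C5_gt0) K0 (powR_ge0 _ _) (powR_ge0 _ _).
Qed.

(** One factor [K] counts the covering balls, the other bounds the ratio of the u-masses of [Q'] and
    [Q]. *)
Lemma box_estimate :
  (wmeas u Q)^-1 * rV_integral Q (fun z => `|g z| `^ q * u z) <=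
  K ^+ 2 * (2 `^ q * (C5 `^ q + 1) * K `^ (q / 2) * (G + H) `^ q).
Proof.
set E := 2 `^ q * _ * _ * _.
have E0 : 0 <= E by rewrite !mulr_ge0 ?powR_ge0 // addr_ge0 ?powR_ge0.
(* Since the inverse of 0 is 0, the left-hand side vanishes in this case. *)
have [uQ|uQ] := eqVneq (wmeas u Q) 0.
  by rewrite uQ invr0 mul0r mulr_ge0 // sqr_ge0.
have {}uQ : 0 < wmeas u Q by rewrite lt_def uQ wmeas_ge0.
have uQ' : 0 < wmeas u Q'.
  exact: lt_le_trans uQ (wmeas_le_enlarged wu Qbox_sub_enlarged).
have [|p [pQ pK Qp]] := Qbox_cover lambda_ge0 lambda_cont (A := Q) wu radius_gt0
  (measurable_Qbox lambda z0 ((1 + e) * s)) (bounded_Qbox lambda z0 ((1 + e) * s))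
  dilation_gt0 uQ'.
  (* The box of radius [d] lies in [Q'], and it contains the ball of radius [d], whose mass is
     bounded below by doubling. *)
  move=> z Qz; split.
    rewrite mulrDl mul1r => w /(Qbox_subset lambda_ge0 lambda_cont radius_gt0 radius_le).
    exact: Qbox_sub.
  apply: (le_trans (wmeas_le_small_ball wu du C3D Qz)); rewrite ler_pM2l //.
  apply: le_wmeas => //; first exact: rho_ball_sub_Qbox.
    exact: measurable_Qbox.
  exact: bounded_Qbox.
rewrite mulrC ler_pdivrMr //.
apply: (@le_trans _ _ ((size p)%:R * (wmeas u Q' * E))).
  have [u0 _ mu _] := wu; have q0 : 0 <= q by exact/ltW/(lt_trans _ q_gt2).
  have powE : (fun z => `|g z| `^ q) = (fun z => `|g z - 0| `^ q).
    by apply/funext => z; rewrite subr0.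
  apply: (@rV_integral_cover _ _ _ p (fun z => rho_ball lambda z (e * s))).
  - by move=> z; rewrite mulr_ge0 ?powR_ge0.
  - have mp : measurable_fun setT ((fun z => `|g z| `^ q) : T -> R).
      by rewrite powE; exact: measurable_powR_dist.
    exact: measurable_funM mp mu.
  - by move=> z _; exact: measurable_rho_ball.
  - move=> z /Qp[w pw Qw]; exists w => //=.
    have -> : e * s = 8 * (3 * d) by rewrite /d; lra.
    by apply: Qbox_sub_rho_ball Qw => //; rewrite mulr_gt0.
  - move=> z /pQ Qz; split; last exact: rho_ball_estimate.
    have -> : (fun z => `|g z| `^ q * u z) = (fun z => `|g z - 0| `^ q * u z).
      by apply/funext => w; rewrite subr0.
    by apply: integrable_powR => //; [exact: measurable_rho_ball|
      exact: bounded_rho_ball].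
apply: (@le_trans _ _ (K * (K * wmeas u Q * E))); last by rewrite expr2; lra.
have uE : 0 <= wmeas u Q' * E by exact: mulr_ge0 (ltW uQ') E0.
apply: ler_pM => //; apply: ler_wpM2r => //.
exact: wmeas_enlarged_le wu du C3D.
Qed.

End local_estimate.

(** The least [k] with the lower bound also satisfies the upper one: for a positive [k] because its
    predecessor fails, for [k = 0] because e < 1 <= c. *)
Lemma exists_dyadic (R : realType) (c e : R) : 1 <= c -> 0 < e -> e < 1 ->
  exists k : nat, c <= 2 ^+ k * e <= 2 * c.
Proof.
move=> c1 e0 e1.
have Pk : exists k, c <= 2 ^+ k * e.
  exists (Num.bound (c / e)); rewrite -ler_pdivrMr //.
  have /archi_boundP/ltW/le_trans : 0 <= c / e by rewrite divr_ge0; lra.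
  by apply; rewrite -natrX ler_nat; exact/ltnW/ltn_expl.
case: (ex_minnP Pk) => k kP kmin; exists k; rewrite kP /=.
case: k kP kmin => [|k] kP kmin; first by rewrite expr0 mul1r; lra.
rewrite exprS -mulrA; have [/kmin|] := leP c (2 ^+ k * e); last by lra.
by rewrite ltnn.
Qed.

Theorem theorem2 (R : realType) (n m : nat) (C1 C2 C3 C4 C5 q : R)
    (n_gt0 : (0 < n)%N) (m_gt0 : (0 < m)%N) (q_gt2 : 2 < q) (C5_gt0 : 0 < C5) :
  exists alpha C10 : R, [/\ 0 < alpha, 0 < C10 &
    forall (lambda : 'rV[R]_n -> R) (u v : 'rV[R]_(n + m) -> R),
      admissible lambda C1 C2 ->
      weight u -> weight v ->
      rho_doubling lambda C3 u -> rho_doubling lambda C4 v ->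
      sobolev_poincare lambda u v q C5 ->
      forall (z0 : 'rV[R]_(n + m)) (s epsilon : R) (g : 'rV[R]_(n + m) -> R),
        0 < s -> 0 < epsilon -> epsilon < 1 -> lipschitz g ->
        let Q := Qbox lambda z0 s in
        let Q' := Qbox lambda z0 ((1 + epsilon) * s) in
        epsilon `^ alpha / C10 *
          ((wmeas u Q)^-1 * rV_integral Q (fun z => `|g z| `^ q * u z)) <=
        ((s ^+ 2 / wmeas v Q *
            rV_integral Q' (fun z => enorm (grad lambda g z) ^+ 2 * v z)) `^ 2^-1
         + ((wmeas u Q)^-1 *
            rV_integral Q' (fun z => g z ^+ 2 * u z)) `^ 2^-1) `^ q].
Proof.
(* The 2 makes [ln D], and hence [alpha], positive whatever [C3] and [C4] are. *)
pose D := Num.max 2 (Num.max C3 C4).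
have D2 : 2 <= D by rewrite le_max lexx.
have D_gt0 : 0 < D by lra.
have C3D : C3 <= D by rewrite !le_max lexx orbT.
have C4D : C4 <= D by rewrite !le_max lexx !orbT.
(* [a] is the base-2 logarithm of [D], so that D^k = (2^k)^a, where 2^k will be comparable to
   1/e. *)
pose a := ln D / ln 2.
have a0 : 0 < a by rewrite divr_gt0 // ln_gt0 //; lra.
have DE : D = 2 `^ a.
  apply: ln_inj; rewrite ?posrE ?powR_gt0 // ln_powR divfK // gt_eqF // ln_gt0 //.
  by rewrite ltr1n.
have q0 : 0 < 2 + q / 2 by lra.
(* 2 + q / 2 is the total exponent of the mass ratio D^k in [box_estimate]. *)
pose alpha := a * (2 + q / 2).
pose c := 2 `^ q * (C5 `^ q + 1).
have c0 : 0 < c by rewrite mulr_gt0 ?powR_gt0 // addr_gt0 ?powR_gt0.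
have [M M0 Mk] : exists2 M : R, 0 < M &
    forall e, 0 < e -> e < 1 -> exists k, 768 <= 2 ^+ k * e <= M.
  exists (2 * 768); first by apply: mulr_gt0; rewrite ltr0n.
  have c1 : 1 <= 768 :> R by rewrite ler1n.
  by move=> e e0 e1; exact: exists_dyadic c1 e0 e1.
exists alpha, (M `^ alpha * c); split.
- exact: mulr_gt0.
- by rewrite mulr_gt0 // powR_gt0.
move=> lambda u v [l0 lc liso _ _] wu wv du dv sp z0 s e g s0 e0 e1 gl; cbv zeta.
have [k /andP[ke ek]] := Mk e e0 e1.
have := box_estimate l0 lc n_gt0 liso wu wv du dv D_gt0 C3D C4D q_gt2 C5_gt0 sp gl
  z0 s0 e0 e1 ke.
rewrite -/c.
set X := (wmeas u (Qbox lambda z0 s))^-1 * rV_integral (Qbox lambda z0 s) _.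
set S := (_ + _) `^ q => XS.
have S0 : 0 <= S by exact: powR_ge0.
have p0 : 0 < M `^ alpha by rewrite powR_gt0.
have e'0 : 0 < e `^ alpha by rewrite powR_gt0.
rewrite mulrAC ler_pdivrMr; last exact: mulr_gt0.
rewrite [leLHS]mulrC -ler_pdivlMr //.
apply: (le_trans XS).
have Dk0 : 0 <= D ^+ k by rewrite exprn_ge0 // ltW.
(* The left-hand side is (2^k)^alpha, and 2^k e <= M by the choice of [k]. *)
have KE : (D ^+ k) ^+ 2 * (D ^+ k) `^ (q / 2) <= M `^ alpha / e `^ alpha.
  have -> : (D ^+ k) ^+ 2 * (D ^+ k) `^ (q / 2) = (2 ^+ k) `^ alpha.
    rewrite -(powR_mulrn 2 Dk0) -powRD; last first.
      by rewrite (gt_eqF (exprn_gt0 _ D_gt0)) implybT.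
    rewrite /alpha powRrM; congr (_ `^ _).
    by rewrite -(powR_mulrn k (ltW D_gt0)) DE -powRrM mulrC powRrM powR_mulrn.
  rewrite ler_pdivlMr // -powRM ?exprn_ge0 ?(ltW e0) //.
  apply: ge0_ler_powR => //; first exact/ltW/mulr_gt0.
    by rewrite nnegrE mulr_ge0 ?exprn_ge0 ?(ltW e0).
  by rewrite nnegrE ltW.
have -> : (D ^+ k) ^+ 2 * (c * (D ^+ k) `^ (q / 2) * S) =
  (D ^+ k) ^+ 2 * (D ^+ k) `^ (q / 2) * (c * S) by ring.
have -> : S * (M `^ alpha * c) / e `^ alpha =
  M `^ alpha / e `^ alpha * (c * S) by ring.
by rewrite ler_wpM2r // mulr_ge0 // ltW.
Qed.
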